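(* Let $d\ge 3$ and let $C\in\mathcal{C}^d_{ar}$ have (normalized, $d$-monotone) generator $\psi$ with pseudo-inverse $\varphi$. For $\mathbf{x}=(x_1,\dots,x_{d-1})\in\mathbb{I}^{d-1}$ and $y\in\mathbb{I}$ set $$K_C(\mathbf{x},[0,y]):=\begin{cases}1, & M(\mathbf{x})=1 \text{ or } \mathbf{x}\in L_0^{1:d-1},\\ 0, & M(\mathbf{x})<1,\ \mathbf{x}\notin L_0^{1:d-1},\ y<f^0(\mathbf{x}),\\ \dfrac{D^-\psi^{(d-2)}\big(\sum_{i=1}^{d-1}\varphi(x_i)+\varphi(y)\big)}{D^-\psi^{(d-2)}\big(\sum_{i=1}^{d-1}\varphi(x_i)\big)}, & M(\mathbf{x})<1,\ \mathbf{x}\notin L_0^{1:d-1},\ y\ge f^0(\mathbf{x}).\end{cases}$$ Then for every $\mathbf{x}$, $y\mapsto K_C(\mathbf{x},[0,y])$ is a distribution function on $\mathbb{I}$, and the induced mapping $K_C:\mathbb{I}^{d-1}\times\mathcal{B}(\mathbb{I})\to\mathbb{I}$ is (a version of) the $(d-1)$-Markov kernel of $C$, i.e. a regular conditional distribution of $Y$ given $\mathbf{X}$ when $(\mathbf{X},Y)$ has distribution function $C$.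
   Context: $\mathbb{I}=[0,1]$. An Archimedean generator is a continuous non-increasing $\psi:[0,\infty)\to\mathbb{I}$ with $\psi(0)=1$, $\lim_{z\to\infty}\psi(z)=0=:\psi(\infty)$, strictly decreasing on $[0,\inf\{z\in[0,\infty]:\psi(z)=0\}]$; its pseudo-inverse is $\varphi(y)=\inf\{z\in[0,\infty]:\psi(z)=y\}$, $y\in\mathbb{I}$. $\psi$ is $d$-monotone if $(-1)^{d-2}\psi^{(d-2)}$ exists on $(0,\infty)$ and is non-negative, non-increasing and convex there. $\mathcal{C}^d_{ar}$ is the class of $d$-dimensional copulas of the form $C(\mathbf{u})=\psi(\varphi(u_1)+\dots+\varphi(u_d))$ with a $d$-monotone generator $\psi$, normalized so that $\psi(1)=1/2$. $D^-$ denotes the left-hand derivative; conventions: $D^-\psi^{(d-2)}(\infty)=0$, $\psi(\infty)=0$, $\psi(u)=1$ for $u<0$. $M(\mathbf{x})=\min_i x_i$. $L_0^{1:d-1}=\{\mathbf{x}\in\mathbb{I}^{d-1}:\sum_{i=1}^{d-1}\varphi(x_i)\ge\varphi(0)\}$, and $f^0(\mathbf{x})=1$ if $\mathbf{x}\in L_0^{1:d-1}$, $f^0(\mathbf{x})=\psi(\varphi(0)-\sum_{i=1}^{d-1}\varphi(x_i))$ otherwise. The $(d-1)$-Markov kernel of a $d$-copula $C$ is a Markov kernel $K$ from $\mathbb{I}^{d-1}$ to $\mathcal{B}(\mathbb{I})$ with $K(\mathbf{X},E)=\mathbb{E}(\mathbf{1}_E(Y)\mid\mathbf{X})$ a.s.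 for all Borel $E$, where $(\mathbf{X},Y)\sim C$; equivalently $\mu_C(G)=\int K(\mathbf{x},G_\mathbf{x})\,d\mu_{C^{1:d-1}}(\mathbf{x})$, with $C^{1:d-1}(\mathbf{x})=C(\mathbf{x},1)$. *)

(* Defs.v *)
From mathcomp Require Import all_boot all_order all_algebra.
From mathcomp Require Import all_classical all_reals all_analysis.
From mathcomp Require Import measurable_realfun.
Import Order.TTheory GRing.Theory Num.Theory numFieldNormedType.Exports.


Local Open Scope ring_scope.
Local Open Scope classical_set_scope.

Section ArchimedeanCopulas.
Context {R : realType}.

(* Extension of a generator psi : [0,oo) -> I to [-oo,+oo] with the paper's
   conventions psi(oo) = 0 and psi(u) = 1 for u < 0. *)
Definition psi_ext (psi : R -> R) (z : \bar R) : R :=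
  match z with
  | r%:E => if r < 0 then 1 else psi r
  | +oo%E => 0
  | -oo%E => 1
  end.

Definition gen_zero (psi : R -> R) : \bar R :=
  ereal_inf [set z : \bar R | (0 <= z)%E /\ psi_ext psi z = 0].

Definition pseudo_inv (psi : R -> R) (y : R) : \bar R :=
  ereal_inf [set z : \bar R | (0 <= z)%E /\ psi_ext psi z = y].

Definition archimedean_generator (psi : R -> R) : Prop :=
  [/\ {within `[0, +oo[, continuous psi},
      (forall x, 0 <= x -> 0 <= psi x <= 1),
      (forall x y, 0 <= x -> x <= y -> psi y <= psi x),
      psi 0 = 1 &
      psi x @[x --> +oo] --> (0 : R)] /\
  (forall x y, 0 <= x -> x < y -> (y%:E <= gen_zero psi)%E ->
     psi y < psi x).

Definition d_monotone (d : nat) (psi : R -> R) : Prop :=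
  let g := fun x => (-1) ^+ (d - 2) * derive1n (d - 2) psi x in
  [/\ (forall k x, (k < d - 2)%N -> 0 < x -> derivable (derive1n k psi) x 1),
      (forall x, 0 < x -> 0 <= g x),
      (forall x y, 0 < x -> x <= y -> g y <= g x) &
      (forall x y t, 0 < x -> 0 < y -> 0 <= t <= 1 ->
         g (t * x + (1 - t) * y) <= t * g x + (1 - t) * g y)].

Definition left_deriv (f : R -> R) (z : R) : R :=
  lim ((fun h : R => (f z - f (z - h)) / h) @ at_right (0 : R)).

(* D^- psi^(d-2), extended by the convention D^- psi^(d-2)(oo) = 0 *)
Definition Dl_ext (d : nat) (psi : R -> R) (z : \bar R) : R :=
  match z with
  | r%:E => left_deriv (derive1n (d - 2) psi) r
  | _ => 0
  end.

Definition sum_phi (psi : R -> R) {n : nat} (x : n.-tuple R) : \bar R :=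
  (\sum_(i < n) pseudo_inv psi (tnth x i))%E.

(* M(x) = min_i x_i  (for x in I^n, n >= 1) *)
Definition minM {n : nat} (x : n.-tuple R) : R :=
  \big[Order.min/1]_(i < n) tnth x i.

Definition inL0 (psi : R -> R) {n : nat} (x : n.-tuple R) : bool :=
  (pseudo_inv psi 0 <= sum_phi psi x)%E.

Definition f0 (psi : R -> R) {n : nat} (x : n.-tuple R) : R :=
  if inL0 psi x then 1
  else psi_ext psi (pseudo_inv psi 0 - sum_phi psi x)%E.

Definition Kcdf (d : nat) (psi : R -> R) (x : (d.-1).-tuple R) (y : R) : R :=
  if (minM x == 1) || inL0 psi x then 1
  else if y < f0 psi x then 0
  else Dl_ext d psi (sum_phi psi x + pseudo_inv psi y)%E /
       Dl_ext d psi (sum_phi psi x).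


Definition arch_copula (psi : R -> R) {n : nat} (x : n.-tuple R) (y : R) : R :=
  psi_ext psi (sum_phi psi x + pseudo_inv psi y)%E.

Definition unitI : set R := [set y | 0 <= y <= 1].
Definition cubeI (n : nat) : set (n.-tuple R) :=
  [set x | forall i, 0 <= tnth x i <= 1].

Definition is_df_on_I (F : R -> R) : Prop :=
  [/\ (forall y, 0 <= y <= 1 -> 0 <= F y <= 1),
      (forall y z, 0 <= y -> y <= z -> z <= 1 -> F y <= F z),
      (forall y, 0 <= y < 1 -> F t @[t --> y^'+] --> F y) &
      F 1 = 1].

(* mu = mu_C : the probability measure on I^n x I (viewed inside R^n x R)
   whose distribution function is C = arch_copula psi. *)
Definition is_copula_measure (psi : R -> R) {n : nat}
    (mu : set (n.-tuple R * R)%type -> \bar R) : Prop :=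
  mu (~` (cubeI n `*` unitI)) = 0%E /\
  forall x y, cubeI n x -> unitI y ->
    mu [set p | (forall i, tnth p.1 i <= tnth x i) /\ p.2 <= y] =
    (arch_copula psi x y)%:E.

Definition induced_kernel (d : nat) (psi : R -> R)
    (K : (d.-1).-tuple R -> set R -> \bar R) : Prop :=
  forall x, cubeI (d.-1) x ->
    K x (~` unitI) = 0%E /\
    forall y, unitI y -> K x `[0, y] = (Kcdf d psi x y)%:E.

Definition is_markov_kernel {n : nat}
    (mu : set (n.-tuple R * R)%type -> \bar R)
    (K : n.-tuple R -> set R -> \bar R) : Prop :=
  (forall E : set R, measurable E -> measurable_fun (cubeI n) (fun x => K x E)) /\
  (forall G : set (n.-tuple R * R)%type, measurable G ->
     mu G = (\int[pushforward mu fst]_(x in cubeI n) K x [set y | G (x, y)])%E).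

End ArchimedeanCopulas.

(* Main.v *)
Require Import Defs.
From HB Require Import structures.
From mathcomp Require Import all_boot all_order all_algebra.
From mathcomp Require Import all_classical all_reals all_analysis.
From mathcomp Require Import measurable_realfun.
From mathcomp Require Import zify ring lra.
Import Order.TTheory GRing.Theory Num.Theory numFieldNormedType.Exports.
Local Open Scope ring_scope.
Local Open Scope classical_set_scope.

(* Put n = d - 1, g_k = (-1)^k psi^(k) for k < n and g_n = (-1)^n D^-psi^(n-1).
   Each g_k is nonnegative, nonincreasing and vanishes at infinity, and for
   0 < u < v
     (v - u) g_(k+1)(v) <= g_k(u) - g_k(v) <= (v - u) g_(k+1)(u),
   so that g_(k+1) integrates to g_k over rays. Iterating over the n coordinates,
   the measure with Lebesgue density g_n(z_1 + ... + z_n + b) on ]0, oo[^n gives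
   mass psi(a_1 + ... + a_n + b) to the orthant {z >= a}. Its image under psi,
   taken coordinatewise, has distribution function
   x |-> psi(phi(x_1) + ... + phi(x_n) + b), hence for b = phi(y) it is the measure
   A |-> mu_C(A x [0, y]), and for b = 0 the law of X. The ratio of the two
   densities is K_C(x, [0, y]), and a pi-system argument extends this from the
   sets A x [0, y] to all Borel sets. *)

(** * Convex functions and the derivatives of a generator *)

(** The last function g_n is only a left derivative and may jump, so the two-sided slope inequality
    takes the place of the fundamental theorem of calculus. It has the same form at every level and
    is stable under adding b to the argument. The coordinates z are chosen because [psi] can be flat
    and has no global inverse: taking images under [psi] only requires that psi(z) <= x is
    equivalent to phi(x) <= z. The delicate place is the hyperplane z_1 + ... + z_n = phi(0) when
    phi(0) is finite. For psi(z) = max(1 - z/p, 0)^n the value g_n(p) is nonzero at p = phi(0),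
    while the kernel is set to 1 there. The densities are therefore cut off at phi(0); below it g_n
    is positive, so the quotient of the two densities never meets a zero denominator.
    Left-continuity of g_n is what makes K_C(x, [0, y]) right-continuous in y, because phi is
    nonincreasing. *)

Section ConvexLeftDerivative.
Context {R : realType}.
Variable G : R -> R.
Hypothesis G_convex : forall x y t : R, 0 < x -> 0 < y -> 0 <= t <= 1 ->
  G (t * x + (1 - t) * y) <= t * G x + (1 - t) * G y.
Hypothesis G_nincr : forall x y : R, 0 < x -> x <= y -> G y <= G x.

Definition left_slope (z h : R) := (G z - G (z - h)) / h.

(** The range h < z keeps z - h positive, where [G] is controlled. By convexity the slopes grow as h
    shrinks, so their supremum is the left derivative at z. *)
Definition left_slopes (z : R) := left_slope z @` `]0, z[.

(** Convexity with t = (v - u) / (v - w), multiplied by v - w so that slope comparisons become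
    polynomial inequalities. *)
Lemma convex_three_points w u v : 0 < w -> w < u -> u < v ->
  (v - w) * G u <= (v - u) * G w + (u - w) * G v.
Proof.
move=> w0 wu uv; have vw : 0 < v - w by lra.
have t01 : 0 <= (v - u) / (v - w) <= 1.
  by rewrite divr_ge0 ?ler_pdivrMr ?mul1r//; lra.
have := G_convex w v _ w0 (lt_trans (lt_trans w0 wu) uv) t01.
have -> : 1 - (v - u) / (v - w) = (u - w) / (v - w) by field; lra.
have -> : (v - u) / (v - w) * w + (u - w) / (v - w) * v = u by field; lra.
rewrite -(ler_pM2l vw) => /le_trans; apply.
by rewrite le_eqVlt; apply/orP; left; apply/eqP; field; lra.
Qed.

Lemma left_slope_nincr z : {in `]0, z[%R &, nonincreasing_fun (left_slope z)}.
Proof.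
move=> h k; rewrite !in_itv/= => /andP[h0 hz] /andP[k0 kz] hk.
rewrite /left_slope ler_pdivrMr// mulrAC ler_pdivlMr//.
move: hk; rewrite le_eqVlt => /predU1P[->//|hk].
have := @convex_three_points (z - k) (z - h) z ltac:(lra) ltac:(lra) ltac:(lra).
nra.
Qed.

Lemma left_slope_le0 z h : 0 < h < z -> left_slope z h <= 0.
Proof.
move=> /andP[h0 hz]; rewrite /left_slope ler_pdivrMr// mul0r subr_le0.
by apply: G_nincr; lra.
Qed.

Lemma left_slopes_has_sup z : 0 < z -> has_sup (left_slopes z).
Proof.
move=> z0; split.
  by exists (left_slope z (z / 2)), (z / 2) => //=; rewrite in_itv/=; lra.
by exists 0 => _ [h /= + <-]; rewrite in_itv/=; exact: left_slope_le0.
Qed.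

(** The scalar c is meant for the sign (-1)^N: the kernel differentiates psi^(N), whereas the convex
    function is (-1)^N psi^(N). *)
Lemma left_deriv_scaled_convex c z : 0 < z ->
  left_deriv (fun x => c * G x) z = c * sup (left_slopes z).
Proof.
move=> z0; rewrite /left_deriv; apply/cvg_lim => //.
rewrite (_ : (fun h => _) = (fun h => c * left_slope z h)); last first.
  by apply/funext => h; rewrite /left_slope; lra.
apply: cvgMr; apply: (@nonincreasing_at_right_cvgr _ _ _ (BLeft z)).
- by rewrite bnd_simp.
- exact: left_slope_nincr.
- by case: (left_slopes_has_sup z z0).
Qed.

Lemma slope_le_sup u v : 0 < u -> u < v ->
  G v - G u <= (v - u) * sup (left_slopes v).
Proof.
move=> u0 uv; rewrite mulrC -ler_pdivrMr ?subr_gt0//.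
apply: ub_le_sup; first by case: (left_slopes_has_sup v (lt_trans u0 uv)).
exists (v - u); first by rewrite /= in_itv/=; lra.
by rewrite /left_slope; congr ((_ - G _) / _); lra.
Qed.

Lemma sup_le_slope u v : 0 < u -> u < v ->
  (v - u) * sup (left_slopes u) <= G v - G u.
Proof.
move=> u0 uv; rewrite mulrC -ler_pdivlMr ?subr_gt0//.
apply: ge_sup; first by case: (left_slopes_has_sup u u0).
move=> _ [h /= + <-]; rewrite in_itv/= => /andP[h0 hu].
rewrite /left_slope ler_pdivrMr// mulrAC ler_pdivlMr ?subr_gt0//.
have := @convex_three_points (u - h) u v ltac:(lra) ltac:(lra) uv.
nra.
Qed.

Lemma sup_left_slopes_ndecr u v : 0 < u -> u <= v ->
  sup (left_slopes u) <= sup (left_slopes v).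
Proof.
move=> u0; rewrite [u <= v]le_eqVlt => /predU1P[->//|uv].
have := slope_le_sup u v u0 uv; have := sup_le_slope u v u0 uv.
move=> /le_trans /[apply]; rewrite ler_pM2l//; lra.
Qed.

(** One chord from w to z nearly attains the supremum at z. For u slightly below z the chord from w
    to u is almost as steep, because G z <= G u, and it is a left slope at u. *)
Lemma sup_left_slopes_left_continuous z e : 0 < z -> 0 < e ->
  exists2 c : R, 0 <= c < z & forall u, c < u -> u <= z ->
    sup (left_slopes z) - e < sup (left_slopes u).
Proof.
move=> z0 e0.
have [_ [h /= + <-]] := sup_adherent e0 (left_slopes_has_sup z z0).
rewrite in_itv/= => /andP[h0 hz] eh.
set S := sup _ in eh *; set w := z - h.
have w0 : 0 < w by rewrite /w; lra.
have {eh} : (S - e) * h < G z - G w by rewrite -ltr_pdivlMr.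
move=> Sw; have Se : S - e < 0.
  have : G z <= G w by apply: G_nincr; rewrite /w; lra.
  nra.
(* At u = c the quantity (S - e)(u - w) equals G z - G w; for u beyond c it is smaller. *)
pose c := z - (G z - G w - (S - e) * h) / (e - S).
have cz : c < z by rewrite /c ltrBlDr ltrDl divr_gt0//; lra.
exists (Num.max c w).
  by rewrite le_max (ltW w0) orbT gt_max cz/= /w; lra.
move=> u; rewrite gt_max => /andP[cu wu] uz.
have u0 : 0 < u by lra.
have := slope_le_sup w u w0 wu.
have uw : 0 < u - w by lra.
rewrite -(ltr_pM2l uw); apply: lt_le_trans.
have : G z <= G u by apply: G_nincr.
move: cu; rewrite /c ltrBlDr -ltrBlDl ltr_pdivlMr; last by lra.
rewrite /w; lra.
Qed.

End ConvexLeftDerivative.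

(** The slope clause says that g_(k+1) is minus a derivative of g_k without asking for
    differentiability, so it also covers the top level. The clauses are stable under dropping g_0,
    which allows induction on the dimension. *)
Definition monotone_chain {R : realType} (n : nat) (g : nat -> R -> R) :=
  [/\ (forall k (x : R), (k <= n)%N -> 0 < x -> 0 <= g k x),
      (forall k (x y : R), (k <= n)%N -> 0 < x -> x <= y -> g k y <= g k x),
      (forall k (e : R), (k <= n)%N -> 0 < e ->
         exists2 M : R, 0 < M & forall x : R, M <= x -> g k x < e) &
      (forall k (u v : R), (k < n)%N -> 0 < u -> u < v ->
         (v - u) * g k.+1 v <= g k u - g k v <= (v - u) * g k.+1 u)].

(* Represents (-1)^k psi^(k) for k <= N and (-1)^(N+1) D^-psi^(N) for k = N + 1,
   where N = d - 2; the values for k > N + 1 are junk. *)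
Definition generator_chain {R : realType} (N : nat) (psi : R -> R) (k : nat)
    (x : R) : R :=
  if (k <= N)%N then (-1) ^+ k * derive1n k psi x
  else (-1) ^+ N.+1 * left_deriv (derive1n N psi) x.

Lemma derive1_mean_value {R : realType} (f : R -> R) (u v : R) :
  (forall x : R, 0 < x -> derivable f x 1) -> 0 < u -> u < v ->
  exists2 c : R, u < c < v & f v - f u = derive1 f c * (v - u).
Proof.
move=> df u0 uv.
have [||c cuv ->] := @MVT R f (derive1 f) u v uv.
- move=> x; rewrite in_itv/= => /andP[ux _].
  by rewrite derive1E; apply/derivableP/df; lra.
- apply: derivable_within_continuous => x; rewrite in_itv/= => /andP[ux _].
  by apply: df; lra.
- by exists c.
Qed.

(** * Signed derivatives of a d-monotone generator *)

Section GeneratorChain.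
Context {R : realType}.
Variables (N : nat) (psi : R -> R).
Hypothesis psi_ge0 : forall x : R, 0 <= x -> 0 <= psi x.
Hypothesis psi_cvg0 : psi x @[x --> +oo] --> (0 : R).
Hypothesis psi_dm : d_monotone N.+2 psi.

Local Notation g := (generator_chain N psi).
Local Notation f k := (derive1n k psi).

Lemma generator_derivable k (x : R) : (k < N)%N -> 0 < x -> derivable (f k) x 1.
Proof. by case: psi_dm => + _ _ _; rewrite !subSS subn0; exact. Qed.

Lemma generator_small (e : R) : 0 < e ->
  exists2 M : R, 0 < M & forall x : R, M <= x -> psi x < e.
Proof.
move=> e0; move/cvgrPdist_lt : psi_cvg0 => /(_ e e0)[M [_ HM]].
exists (Num.max 1 (M + 1)) => [|x]; first by rewrite lt_max ltr01.
rewrite ge_max => /andP[x1 Mx]; have := HM x; rewrite sub0r normrN.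
by move=> /(_ ltac:(lra)); apply: le_lt_trans; exact: ler_norm.
Qed.

(* A derivative bounded away from zero near infinity makes the antiderivative
   exceed 1 there, and so on down to psi, which tends to zero. *)
Lemma derivative_not_bounded_away k (s c M : R) : (k <= N)%N -> s = 1 \/ s = -1 ->
  0 < c -> ~ (forall x : R, 0 < x -> M <= x -> c <= s * f k x).
Proof.
move=> + s1; elim: k c M => [|k IH] c M kN c0 cs.
  have [M' M'0 psiM'] := generator_small c c0.
  have MM : M <= Num.max M M' by rewrite le_max lexx.
  have MM' : M' <= Num.max M M' by rewrite le_max lexx orbT.
  have := cs (Num.max M M') (lt_le_trans M'0 MM') MM.
  have := psiM' _ MM'.
  have := psi_ge0 _ (ltW (lt_le_trans M'0 MM')).
  by rewrite derive1n0; case: s1 => ->; lra.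
pose M1 := Num.max 1 M.
have M10 : 0 < M1 by rewrite lt_max ltr01.
have MM1 : M <= M1 by rewrite le_max lexx orbT.
pose M2 := M1 + (1 + `|s * f k M1|) / c.
have M12 : M1 < M2 by rewrite ltrDl divr_gt0// ltr_wpDr.
apply: (IH 1 M2 (ltnW kN) ltr01).
move=> x x0 M2x; have M1x := lt_le_trans M12 M2x.
have [d /andP[M1d dx]] := derive1_mean_value (f k) M1 x
  (fun x => generator_derivable k x kN) M10 M1x.
have := cs d ltac:(lra) ltac:(lra); rewrite derive1nS/=.
have : 1 + `|s * f k M1| <= c * (x - M1).
  by rewrite [c * _]mulrC -ler_pdivrMr// lerBrDl.
have := ler_norm (- (s * f k M1)); rewrite normrN.
have : 0 < x - M1 by lra.
move: (f k x) (f k M1) (derive1 _ d) => fx fM fd h1 h2 h3 h4 h5.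
nra.
Qed.

Let sign_or k : (-1 : R) ^+ k = 1 \/ (-1 : R) ^+ k = -1.
Proof. by rewrite -signr_odd; case: odd; [right|left]. Qed.

Lemma generator_mean_value k (u v : R) : (k < N)%N -> 0 < u -> u < v ->
  exists2 c : R, u < c < v & g k u - g k v = g k.+1 c * (v - u).
Proof.
move=> kN u0 uv; have [c cuv H] := derive1_mean_value (f k) u v
  (fun x => generator_derivable k x kN) u0 uv.
exists c => //; rewrite /generator_chain (ltnW kN) kN derive1nS exprS.
rewrite -mulrBr -opprB H; lra.
Qed.

(** d-monotonicity speaks only of order N, so the induction descends from N. A nonnegative g_(i+1)
    makes g_i nonincreasing; were g_i negative somewhere, it would stay below that value, which
    [derivative_not_bounded_away] forbids. *)
Lemma generator_chain_monotone k : (k <= N)%N ->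
  (forall x : R, 0 < x -> 0 <= g k x) /\
  (forall x y : R, 0 < x -> x <= y -> g k y <= g k x).
Proof.
move=> kN; rewrite -(subKn kN); elim: (N - k)%N (leq_subr k N) => [_|j IH jN].
  rewrite subn0; case: psi_dm => _; rewrite !subSS subn0 => h1 h2 _.
  by rewrite /generator_chain leqnn.
have [ge0 _] := IH (ltnW jN); set i := (N - j.+1)%N.
have iE : (N - j)%N = i.+1 by rewrite /i subnSK.
rewrite iE in ge0.
have iN : (i < N)%N by rewrite /i; lia.
have mono (x y : R) : 0 < x -> x <= y -> g i y <= g i x.
  move=> x0; rewrite [x <= y]le_eqVlt => /predU1P[->//|xy].
  have [c /andP[xc _] H] := generator_mean_value i x y iN x0 xy.
  have : 0 <= g i.+1 c * (y - x) by rewrite mulr_ge0 ?ge0//; lra.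
  by rewrite -H; lra.
split => // x x0; rewrite leNgt; apply/negP => gx.
have gx0 : 0 < - g i x by lra.
apply: (derivative_not_bounded_away i (- (-1) ^+ i) (- g i x) x (ltnW iN)) => //.
  by case: (sign_or i) => ->; [right|left; rewrite opprK].
move=> y y0 xy; rewrite mulNr lerN2.
by have := mono x y x0 xy; rewrite /generator_chain (ltnW iN).
Qed.

Lemma generator_chain_small k (e : R) : (k <= N)%N -> 0 < e ->
  exists2 M : R, 0 < M & forall x : R, M <= x -> g k x < e.
Proof.
move=> kN e0; apply: contrapT => H.
apply: (derivative_not_bounded_away k ((-1) ^+ k) e 0 kN (sign_or k) e0).
move=> x x0 _; rewrite leNgt; apply/negP => gx; apply: H; exists x => // y xy.
have [_ /(_ x y x0 xy)] := generator_chain_monotone k kN.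
by move=> /le_lt_trans; apply; rewrite /generator_chain kN.
Qed.

Lemma generator_top_convex (x y t : R) : 0 < x -> 0 < y -> 0 <= t <= 1 ->
  g N (t * x + (1 - t) * y) <= t * g N x + (1 - t) * g N y.
Proof.
by case: psi_dm => _ _ _; rewrite !subSS subn0 /generator_chain leqnn; exact.
Qed.

Let top_nincr := (generator_chain_monotone N (leqnn N)).2.

Lemma generator_chain_topE (x : R) : 0 < x ->
  g N.+1 x = - sup (left_slopes (g N) x).
Proof.
move=> x0; rewrite {1}/generator_chain ltnn.
have -> : f N = (fun x => (-1) ^+ N * g N x).
  apply/funext => y; rewrite /generator_chain leqnn mulrA -exprMn.
  by rewrite mulrNN mulr1 expr1n mul1r.
rewrite (left_deriv_scaled_convex _ generator_top_convex top_nincr)//.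
by rewrite mulrA -exprD addSn exprS -signr_odd oddD addbb expr0 mulr1 mulN1r.
Qed.

Lemma generator_chainP : monotone_chain N.+1 g.
Proof.
have topslope (u v : R) : 0 < u -> u < v ->
    (v - u) * g N.+1 v <= g N u - g N v <= (v - u) * g N.+1 u.
  move=> u0 uv; rewrite !generator_chain_topE//; last exact: lt_trans uv.
  have := slope_le_sup _ top_nincr u v u0 uv.
  have := sup_le_slope _ generator_top_convex top_nincr u v u0 uv.
  lra.
have top_ge0 (x : R) : 0 < x -> 0 <= g N.+1 x.
  move=> x0; have := topslope x (x + 1) x0 ltac:(lra).
  have := top_nincr x (x + 1) x0 ltac:(lra); lra.
split.
- move=> k x; rewrite leq_eqVlt ltnS => /predU1P[->|kN]; first exact: top_ge0.
  by have [+ _] := generator_chain_monotone k kN; exact.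
- move=> k x y; rewrite leq_eqVlt ltnS => /predU1P[->|kN] x0 xy; last first.
    by have [_ +] := generator_chain_monotone k kN; apply.
  rewrite !generator_chain_topE//; last exact: lt_le_trans xy.
  rewrite lerN2.
  exact: (sup_left_slopes_ndecr _ generator_top_convex top_nincr).
- move=> k e; rewrite leq_eqVlt ltnS => /predU1P[->|kN] e0; last first.
    exact: generator_chain_small.
  have [M M0 HM] := generator_chain_small N e (leqnn N) e0.
  (* Since x - M >= 1, the slope inequality between M and x bounds [g N.+1 x] by [g N M]. *)
  exists (M + 1) => [|x Mx]; first by lra.
  have := topslope M x M0 ltac:(lra).
  have := (generator_chain_monotone N (leqnn N)).1 x ltac:(lra).
  have := HM M (lexx _); have := top_ge0 x ltac:(lra); nra.
- move=> k u v; rewrite ltnS leq_eqVlt => /predU1P[->|kN] u0 uv.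
    exact: topslope.
  have [c /andP[uc cv] ->] := generator_mean_value k u v kN u0 uv.
  have [_ mono] := generator_chain_monotone k.+1 kN.
  rewrite [g k.+1 c * _]mulrC; apply/andP; split; rewrite ler_pM2l ?subr_gt0//.
  - by apply: mono; lra.
  - by apply: mono; lra.
Qed.

Lemma generator_chain_left_continuous (x e : R) : 0 < x -> 0 < e ->
  exists2 c : R, 0 <= c < x & forall u, c < u -> u <= x -> g N.+1 u < g N.+1 x + e.
Proof.
move=> x0 e0; have [c /andP[c0 cx] Hc] := sup_left_slopes_left_continuous _
  top_nincr x e x0 e0.
exists c => [|u cu ux]; first by rewrite c0.
rewrite !generator_chain_topE//; last exact: le_lt_trans cu.
have := Hc u cu ux; lra.
Qed.

End GeneratorChain.

Section MonotoneChain.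
Context {R : realType}.
Variables (n : nat) (g : nat -> R -> R).
Hypothesis gP : monotone_chain n g.

(** To the right of z, vanishing passes from g_k to g_(k+1) by the lower slope bound. At z itself
    the upper bound gives g_k(z) <= (v - z) g_(k+1)(z) for every v > z, which requires a next level;
    hence the restriction k < n. *)
Lemma monotone_chain_eq0 (z : R) : 0 < z -> (forall x : R, z <= x -> g 0 x = 0) ->
  forall k, (k <= n)%N ->
  (forall x : R, z < x -> g k x = 0) /\ ((k < n)%N -> g k z = 0).
Proof.
move=> z0 gz; case: gP => ge0 mono _ slope; elim=> [_|k IH kn].
  by split => [x zx|_]; apply: gz => //; exact: ltW.
have [eq0 /(_ kn) eqz] := IH (ltnW kn).
have eqS (x : R) : z < x -> g k.+1 x = 0.
  move=> zx; have := slope k z x kn z0 zx; rewrite eqz eq0//.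
  have := ge0 k.+1 x kn (lt_trans z0 zx) => ? ?.
  apply: le_anti; apply/andP; split => //; nra.
split => // kn'; apply: le_anti; rewrite (ge0 _ _ kn z0) andbT.
have C0 := ge0 k.+2 z kn' z0.
apply/ler_addgt0Pr => e e0; rewrite add0r.
pose v := z + e / (g k.+2 z + 1).
have zv : z < v by rewrite ltrDl divr_gt0// ltr_wpDl.
have := slope k.+1 z v kn' z0 zv; rewrite (eqS v zv) subr0 => /andP[_ /le_trans]; apply.
rewrite /v addrAC subrr add0r mulrAC ler_pdivrMr ?ltr_wpDl//; nra.
Qed.

(** If g_(k+1)(z) were 0, the upper slope bound would give g_k(z) <= g_k(v) for all v > z, against
    decay at infinity. *)
Lemma monotone_chain_gt0 (z : R) : 0 < z -> 0 < g 0 z ->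
  forall k, (k <= n)%N -> 0 < g k z.
Proof.
move=> z0 gz; case: gP => ge0 mono small slope; elim=> [//|k IH kn].
rewrite lt_neqAle ge0// andbT eq_sym; apply/eqP => gS.
have gk := IH (ltnW kn).
have [M M0 HM] := small k _ (ltnW kn) gk.
have zv : z < z + M by lra.
have := slope k z (z + M) kn z0 zv; rewrite gS mulr0 => /andP[_].
have := HM (z + M) ltac:(lra); lra.
Qed.

End MonotoneChain.

(** * Integrals over rays and orthants *)

Section SlopeIntegral.
Context {R : realType}.
Variables (h G : R -> R) (a : R).
Hypothesis h_ge0 : forall x : R, a < x -> 0 <= h x.
Hypothesis h_nincr : forall x y : R, a < x -> x <= y -> h y <= h x.
Hypothesis slope : forall u v : R, a < u -> u < v ->
  (v - u) * h v <= G u - G v <= (v - u) * h u.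

Local Notation leb := (@lebesgue_measure R).

Lemma nonincreasing_ray_measurable : measurable_fun `]a, +oo[ h.
Proof.
apply: (measurability (@RGenCInfty.G R)) => [|/= _ [_] [r] -> <-].
  exact: RGenCInfty.measurableE.
apply: is_interval_measurable => s t/=.
rewrite !in_itv/= !andbT => -[as_ hs] [at_ ht] u /andP[su ut].
have au := lt_le_trans as_ su.
by rewrite !in_itv/= !andbT; split => //; apply: (le_trans ht); exact: h_nincr.
Qed.

Let I u v := (\int[leb]_(x in `]u, v]) (h x)%:E)%E.

Let measurable_h u v : a < u -> measurable_fun `]u, v] (EFin \o h).
Proof.
move=> au; apply/measurable_EFinP.
apply: measurable_funS nonincreasing_ray_measurable => // x /=.
by rewrite !in_itv/= andbT => /andP[ux _]; exact: lt_trans ux.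
Qed.

Let I_bounds u v : a < u -> u < v ->
  (((v - u) * h v)%:E <= I u v <= ((v - u) * h u)%:E)%E.
Proof.
move=> au uv.
have cstE c : (\int[leb]_(x in `]u, v]) (cst c%:E) x = ((v - u) * c)%:E)%E.
  rewrite integral_cst//= lebesgue_measure_itv/= lte_fin uv -EFinB -EFinM.
  by rewrite mulrC.
rewrite -!cstE /I; apply/andP; split; apply: ge0_le_integral => //=.
- by move=> x _; rewrite lee_fin h_ge0//; exact: lt_trans uv.
- exact: measurable_h.
- by move=> x; rewrite in_itv/= => /andP[ux xv]; rewrite lee_fin h_nincr//; lra.
- by move=> x; rewrite in_itv/= => /andP[ux xv]; rewrite lee_fin h_ge0//; lra.
- exact: measurable_h.
- by move=> x; rewrite in_itv/= => /andP[ux xv]; rewrite lee_fin h_nincr//; lra.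
Qed.

Let I_fin u v : a < u -> u < v -> I u v \is a fin_num.
Proof.
move=> au uv; have /andP[lo up] := I_bounds u v au uv.
rewrite ge0_fin_numE; first exact: le_lt_trans up (ltry _).
by apply: le_trans lo; rewrite lee_fin mulr_ge0 ?h_ge0//; lra.
Qed.

Let I_split u m v : a < u -> u < m -> m < v ->
  fine (I u v) = fine (I u m) + fine (I m v).
Proof.
move=> au um mv; have am := lt_trans au um.
rewrite -fineD ?I_fin//; congr fine.
have E : `]u, v]%classic = `]u, m]%classic `|` `]m, v]%classic.
  by apply: itv_bndbnd_setU; rewrite bnd_simp ltW.
rewrite /I E ge0_integral_setU//=.
- by have := measurable_h u v au; rewrite E.
- by move=> x [|]/=; rewrite in_itv/= => /andP[ux _]; rewrite lee_fin h_ge0//; lra.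
- apply/disj_setPS => y [/=]; rewrite 2!in_itv/= => /andP[_ yx] /andP[].
  by rewrite ltNge yx.
Qed.

(* Both sides lie between the same lower and upper sums; halving the
   interval halves the gap between these. *)
Let bisection k u v : a < u -> u < v ->
  `|fine (I u v) - (G u - G v)| <= (v - u) * (h u - h v) / 2 ^+ k.
Proof.
elim: k u v => [|k IH] u v au uv.
  rewrite expr0 divr1; have := slope u v au uv; have := I_bounds u v au uv.
  have [J ->] : exists J, I u v = J%:E.
    by exists (fine (I u v)); rewrite fineK// I_fin.
  by rewrite !lee_fin/= ler_norml; lra.
pose m := (u + v) / 2.
have um : u < m by rewrite /m; lra.
have mv : m < v by rewrite /m; lra.
rewrite (I_split u m v)//.
have -> : fine (I u m) + fine (I m v) - (G u - G v) =
   (fine (I u m) - (G u - G m)) + (fine (I m v) - (G m - G v)) by ring.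
apply: (le_trans (ler_normD _ _)).
apply: (le_trans (lerD (IH u m au um) (IH m v (lt_trans au um) mv))).
have p : 2 ^+ k != 0 :> R by rewrite expf_neq0.
rewrite le_eqVlt; apply/orP; left; apply/eqP.
by rewrite exprS /m; field.
Qed.

Lemma integral_slope_bounded u v : a < u -> u < v ->
  (\int[leb]_(x in `]u, v]) (h x)%:E = (G u - G v)%:E)%E.
Proof.
move=> au uv; rewrite -[LHS](fineK (I_fin u v au uv)); congr EFin.
apply/eqP; rewrite -subr_eq0 -normr_le0; apply/ler_addgt0Pr => e e0.
rewrite add0r; set C := (v - u) * (h u - h v).
have C0 : 0 <= C by rewrite mulr_ge0// subr_ge0 ?h_nincr// ltW.
have [k Ck] : exists k, C / e < 2 ^+ k.
  exists (Num.truncn (C / e)).+1.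
  apply: lt_trans (_ : (Num.truncn (C / e)).+1%:R < _); first exact: truncnS_gt.
  by rewrite -natrX ltr_nat ltn_expl.
apply: (le_trans (bisection k u v au uv)); rewrite -/C.
rewrite ler_pdivrMr ?exprn_gt0//.
by move: Ck; rewrite ltr_pdivrMr// mulrC => /ltW.
Qed.

Hypothesis G_pinfty : G x @[x --> +oo] --> (0 : R).
Hypothesis G_right : G x @[x --> a^'+] --> G a.

(** The slope inequality holds strictly above a only, so the ray is exhausted from inside and
    right-continuity of [G] recovers the value at a. *)
Lemma integral_slope :
  (\int[leb]_(x in `]a, +oo[) (h x)%:E = (G a)%:E)%E.
Proof.
pose u k : R := a + k.+1%:R^-1.
(* The offset 2 gives u k < v k already at k = 0, where u 0 = a + 1. *)
pose v k : R := a + k.+2%:R.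
have au k : a < u k by rewrite ltrDl invr_gt0.
have uv k : u k < v k.
  rewrite ltrD2l; apply: le_lt_trans (_ : 1 < _); last by rewrite ltr1n.
  by rewrite invf_le1 ?ler1n.
have cov : `]a, +oo[%classic = \bigcup_k `]u k, v k]%classic.
  apply/seteqP; split => x /=; last first.
    by move=> [k _ /=]; rewrite !in_itv/= andbT => /andP[+ _]; exact: lt_trans.
  rewrite in_itv/= andbT => ax.
  have xa : 0 < x - a by rewrite subr_gt0.
  pose k := maxn (Num.truncn (x - a)^-1) (Num.truncn (x - a)).
  exists k => //=; rewrite in_itv/=; apply/andP; split.
    rewrite /u -ltrBrDl invf_plt ?posrE//.
    apply: (lt_le_trans (truncnS_gt _)).
    by rewrite ler_nat ltnS leq_maxl.
  rewrite /v -lerBlDl; apply/ltW; apply: (lt_le_trans (truncnS_gt _)).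
  by rewrite ler_nat ltnS (leq_trans (leq_maxr _ _) (leqnSn _)).
apply/esym; rewrite cov; apply: cvg_unique (_ :
  (\int[leb]_(x in `]u k, v k]) (h x)%:E)%E @[k --> \oo] --> _) => //.
  rewrite (_ : (fun k => _) = (fun k => (G (u k) - G (v k))%:E)); last first.
    by apply/funext => k; exact: integral_slope_bounded.
  apply: cvg_EFin; first by near=> k.
  rewrite -[G a]subr0; apply: cvgB.
    move/cvg_at_rightP : G_right; apply; split => //.
    rewrite -[X in _ --> X]addr0; apply: cvgD; first exact: cvg_cst.
    exact: cvg_harmonic.
  move/cvg_pinftyP : G_pinfty; apply.
  apply/cvgryPge => M; near=> k.
  have : M - a <= k%:R by near: k; exact: nbhs_infty_ger.
  rewrite /v -!natr1; lra.
apply: ge0_nondecreasing_set_cvg_integral => //.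
- move=> j k jk; apply/subsetPset; apply: subset_itv; rewrite bnd_simp.
    by rewrite lerD2l lef_pV2 ?posrE// ler_nat ltnS.
  by rewrite lerD2l ler_nat !ltnS.
- by move=> k; exact: measurable_h.
- move=> k x /=; rewrite in_itv/= => /andP[ux _].
  by rewrite lee_fin h_ge0//; exact: lt_trans ux.
Unshelve. all: by end_near. Qed.

End SlopeIntegral.

(* [pushforward m f] is a measure only through a proof that [f] is measurable,
   which unification cannot recover from [f]. *)
Definition image_measure d d' (T1 : measurableType d) (T2 : measurableType d')
    (R : realFieldType) (m : {measure set T1 -> \bar R}) (f : T1 -> T2)
    (mf : measurable_fun [set: T1] f) : {measure set T2 -> \bar R}.
Proof.
by unshelve refine (pushforward m f : {measure set T2 -> \bar R}); exact: mf.
Defined.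
Arguments image_measure {d d' T1 T2 R} m {f} mf.

(** * Lebesgue measure on tuples *)

Section LebesgueTuple.
Context {R : realType}.

Definition tuple_cons n (p : R * n.-tuple R) : n.+1.-tuple R :=
  [tuple of p.1 :: p.2].

Lemma measurable_tuple_cons n : measurable_fun setT (@tuple_cons n).
Proof. by apply: measurable_cons; [exact: measurable_fst|exact: measurable_snd]. Qed.

Lemma measurable_thead n : measurable_fun setT (@thead n R).
Proof. exact: measurable_tnth. Qed.

Section Cons.
Context {n : nat}.
Variable m : {sigma_finite_measure set (n.-tuple R) -> \bar R}.

Definition lebesgue_cons : set (n.+1.-tuple R) -> \bar R :=
  image_measure (lebesgue_measure \x m)%E (measurable_tuple_cons n).

HB.instance Definition _ := Measure.on lebesgue_cons.

Let lebesgue_cons_sigma_finite : sigma_finite setT lebesgue_cons.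
Proof.
have /sigma_finiteP[F [UF ndF Ffin]] : sigma_finite setT (@lebesgue_measure R).
  exact: sigma_finiteT.
have /sigma_finiteP[G [UG ndG Gfin]] := sigma_finiteT m.
exists (fun k => [set t : n.+1.-tuple R |
    F k (thead t) /\ G k [tuple of behead t]]) => [|k].
  apply/seteqP; split => // t _.
  have [i _ Fi] : (\bigcup_k F k) (thead t) by rewrite -UF.
  have [j _ Gj] : (\bigcup_k G k) [tuple of behead t] by rewrite -UG.
  exists (maxn i j) => //; split.
    by have /subsetPset := ndF _ _ (leq_maxl i j); apply.
  by have /subsetPset := ndG _ _ (leq_maxr i j); apply.
have [mF Fk] := Ffin k; have [mG Gk] := Gfin k; split.
  apply: measurableI; rewrite -[X in measurable X]setTI.
    exact: measurable_thead.
  exact: (@measurable_behead _ R n).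
rewrite /lebesgue_cons/= /pushforward.
rewrite (_ : _ @^-1` _ = F k `*` G k).
  by rewrite product_measure1E// lte_mul_pinfty// ge0_fin_numE.
apply/funext => -[x t]; rewrite /preimage /setX /mkset.
have -> : [tuple of behead (tuple_cons n (x, t))] = t by exact/val_inj.
by rewrite /tuple_cons theadE.
Qed.

HB.instance Definition _ := Measure_isSigmaFinite.Build _ _ _
  lebesgue_cons lebesgue_cons_sigma_finite.

End Cons.

(** Each step adds one coordinate, so Tonelli integrates the coordinates one at a time;
    sigma-finiteness is kept in the type for that purpose. In dimension 0 integration is evaluation
    at the empty tuple. *)
Fixpoint lebesgue_tuple n : {sigma_finite_measure set (n.-tuple R) -> \bar R} :=
  match n with
  | 0 => \d_([tuple])
  | n'.+1 => lebesgue_cons (lebesgue_tuple n')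
  end.

Lemma integral_lebesgue_tupleS n (F : n.+1.-tuple R -> \bar R) :
  measurable_fun setT F -> (forall t, 0 <= F t)%E ->
  (\int[lebesgue_tuple n.+1]_t F t =
   \int[lebesgue_measure]_x \int[lebesgue_tuple n]_t F (tuple_cons n (x, t)))%E.
Proof.
move=> mF F0; rewrite [LHS]ge0_integral_pushforward//; last exact: measurable_tuple_cons.
rewrite preimage_setT fubini_tonelli1//.
  by apply: measurableT_comp => //; exact: measurable_tuple_cons.
by move=> p; exact: F0.
Qed.

End LebesgueTuple.

Definition right_continuous_at {R : realType} (f : R -> R) (x : R) :=
  forall e : R, 0 < e -> exists2 c : R, 0 < c &
    forall y : R, x < y -> y < x + c -> `|f x - f y| < e.

(** Encodes both conventions at infinity, for psi and for the left derivative of psi^(d-2). *)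
Definition real_part_or0 {R : realType} (f : R -> R) (z : \bar R) : R :=
  if z is r%:E then f r else 0.

(** Strict positivity keeps sums in ]0, oo[, where chains are controlled. The closed bound matches
    phi(c) <= z, and an infinite bound makes the orthant empty. *)
Definition in_orthant {R : realType} {n} (a : n.-tuple (\bar R))
    (z : n.-tuple R) : bool :=
  [forall i, (0 < tnth z i) && (tnth a i <= (tnth z i)%:E)%E].

Definition tuple_sum {R : realType} {n} (z : n.-tuple R) : R :=
  \sum_(i < n) tnth z i.

(** Replaces the uncontrolled values on ]-oo, 0], so that monotonicity on ]0, oo[ yields
    measurability on the whole line. *)
Definition extend0 {R : realType} (f : R -> R) (x : R) : R :=
  if 0 < x then f x else 0.

Section Orthants.
Context {R : realType}.

Lemma extend0_measurable (f : R -> R) :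
  (forall x y : R, 0 < x -> x <= y -> f y <= f x) ->
  measurable_fun setT (extend0 f).
Proof.
move=> f_nincr; apply: measurable_fun_if => //.
  by apply: measurable_fun_ltr => //; exact: measurable_cst.
apply: measurable_funS (nonincreasing_ray_measurable f 0 f_nincr) => //.
by move=> x [_ /=]; rewrite in_itv/= andbT.
Qed.

Lemma in_orthant_measurable n (a : n.-tuple (\bar R)) :
  measurable_fun setT (in_orthant a).
Proof.
apply: (measurable_fun_bool true); rewrite setTI.
rewrite (_ : _ @^-1` _ = \bigcap_(i in [set: 'I_n])
    (fun z => tnth z i) @^-1` [set x | (0 < x) && (tnth a i <= x%:E)%E]).
  apply: fin_bigcap_measurable => // i _.
  rewrite -[X in measurable X]setTI; apply: measurable_tnth => //.
  apply: is_interval_measurable => x y /= /andP[x0 ax] _ z /andP[xz _].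
  by rewrite (lt_le_trans x0 xz)/= (le_trans ax)// lee_fin.
apply/seteqP; split => z /=.
  by move=> /forallP H i _; exact: H.
by move=> H; apply/forallP => i; exact: H.
Qed.

Lemma tuple_sum_measurable n : measurable_fun setT (@tuple_sum R n).
Proof.
by apply: measurable_sum => i; exact: measurable_tnth.
Qed.

Lemma tuple_sum_cons n x (t : n.-tuple R) :
  tuple_sum (tuple_cons n (x, t)) = x + tuple_sum t.
Proof.
rewrite /tuple_sum big_ord_recl tnth0; congr (_ + _).
by apply: eq_bigr => i _; rewrite tnthS.
Qed.

Lemma in_orthant_cons n (a : n.+1.-tuple (\bar R)) x (t : n.-tuple R) :
  in_orthant a (tuple_cons n (x, t)) =
  (0 < x) && (thead a <= x%:E)%E && in_orthant [tuple of behead a] t.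
Proof.
apply/forallP/andP => [H|[H /forallP Ht] i].
  split; first by have := H ord0; rewrite tnth0.
  apply/forallP => i; have := H (lift ord0 i).
  by rewrite tnthS [in tnth a _](tuple_eta a) tnthS.
have [j ->|->] := unliftP ord0 i; last by rewrite tnth0.
by have := Ht j; rewrite tnthS [in X in _ -> X](tuple_eta a) tnthS.
Qed.

Lemma tuple_sum_gt0 n (a : n.+1.-tuple (\bar R)) (z : n.+1.-tuple R) :
  in_orthant a z -> 0 < tuple_sum z.
Proof.
move=> /forallP H; rewrite /tuple_sum big_ord_recl ltr_pwDl//.
  by have /andP[] := H ord0.
by apply: sumr_ge0 => i _; have /andP[/ltW] := H (lift ord0 i).
Qed.

End Orthants.

Section ChainIntegral.
Context {R : realType}.

Lemma monotone_chain_shift n (g : nat -> R -> R) :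
  monotone_chain n.+1 g -> monotone_chain n (fun k => g k.+1).
Proof.
move=> [ge0 mono small slope]; split => k.
- by move=> x kn; exact: ge0.
- by move=> x y kn; exact: mono.
- by move=> e kn; exact: small.
- by move=> u v kn; exact: slope.
Qed.

Lemma monotone_chain_right_continuous n (g : nat -> R -> R) x :
  monotone_chain n.+1 g -> 0 < x -> right_continuous_at (g 0) x.
Proof.
move=> [ge0 mono _ slope] x0 e e0; have C0 := ge0 1%N x isT x0.
exists (e / (g 1%N x + 1)) => [|y xy yc]; first by rewrite divr_gt0// ltr_wpDl.
have := slope 0 x y isT x0 xy => /andP[_].
have := mono 0 x y isT x0 (ltW xy).
have : (y - x) * (g 1%N x + 1) < e.
  by rewrite -ltr_pdivlMr ?ltr_wpDl//; lra.
rewrite ltr_norml; nra.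
Qed.

(** The domain is ]r, oo[ up to its endpoint. Right-continuity is assumed because c + r may be 0,
    where the chain says nothing about [g 0]. *)
Let integral_orthant_side n (g : nat -> R -> R) (c r : R) :
  monotone_chain n.+1 g -> 0 <= c -> 0 <= r ->
  right_continuous_at (g 0) (c + r) ->
  (\int[lebesgue_measure]_x
     (if (0 < x) && (r <= x) then g 1 (c + x) else 0)%:E = (g 0 (c + r))%:E)%E.
Proof.
move=> gP c0 r0 g_right; have [ge0 mono small slope] := gP.
have h_ge0 (x : R) : r < x -> 0 <= g 1 (c + x).
  by move=> rx; apply: ge0 => //; lra.
have h_nincr (x y : R) : r < x -> x <= y -> g 1 (c + y) <= g 1 (c + x).
  by move=> rx xy; apply: mono => //; lra.
transitivity (\int[lebesgue_measure]_(x in `]r, +oo[) (g 1 (c + x))%:E)%E.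
  have [r_gt0|r_le0] := ltP 0 r.
    rewrite integral_itv_obnd_cbnd; last first.
      apply/measurable_EFinP.
      exact: (nonincreasing_ray_measurable (fun x => g 1 (c + x)) r h_nincr).
    rewrite [RHS]integral_mkcond; apply: eq_integral => x _.
    rewrite patchE; case: ifPn => [/andP[x0 rx]|].
      by rewrite mem_set//= in_itv/= rx.
    rewrite negb_and -!ltNge => H; rewrite memNset//= in_itv/= andbT.
    by apply/negP; rewrite -ltNge; case/orP : H => //; lra.
  have -> : r = 0 by lra.
  rewrite [RHS]integral_mkcond; apply: eq_integral => x _.
  rewrite patchE; case: ifPn => [/andP[x0 rx]|].
    by rewrite mem_set//= in_itv/= x0.
  rewrite negb_and -!leNgt -ltNge => H; rewrite memNset//= in_itv/= andbT.
  by apply/negP; rewrite -leNgt; case/orP : H => //; lra.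
rewrite (integral_slope (fun x => g 1 (c + x)) (fun x => g 0 (c + x)))//.
- move=> u v ru uv.
  have := slope 0 (c + u) (c + v) isT ltac:(lra) ltac:(lra).
  by rewrite (_ : c + v - (c + u) = v - u)//; ring.
- apply/cvgrPdist_lt => e e0; have [M M0 HM] := small 0 e isT e0.
  near=> x.
  have x0 : 0 < x by near: x; apply: nbhs_pinfty_gt; exact: num_real.
  rewrite sub0r normrN ger0_norm; last by apply: ge0 => //; exact: ltr_wpDl.
  apply: HM; apply: (@le_trans _ _ x); last by rewrite lerDr.
  by near: x; apply: nbhs_pinfty_ge; exact: num_real.
- apply/cvgrPdist_lt => e e0; have [d d0 Hd] := g_right e e0.
  near=> x; apply: Hd.
    by rewrite ltrD2l; near: x; exact: nbhs_right_gt.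
  by rewrite -addrA ltrD2l; near: x; apply: nbhs_right_lt; rewrite ltrDl.
Unshelve. all: by end_near. Qed.

(** With the first coordinate fixed at x, the remaining integral is an instance for the chain k |->
    g_(k+1) with offset s + x; the first coordinate then contributes one slope integral. The offset
    can be 0 only in the outermost call, as s + x > 0 inside, and only there is right-continuity at
    0 a separate assumption. *)
Lemma chain_integral n (g : nat -> R -> R) (s : R) (a : n.-tuple (\bar R)) :
  monotone_chain n g -> 0 <= s -> (0 < s \/ right_continuous_at (g 0) 0) ->
  (forall i, 0 <= tnth a i)%E ->
  (\int[lebesgue_tuple n]_z
     (if in_orthant a z then g n (s + tuple_sum z)%R else 0%R)%:E =
   (real_part_or0 (g 0) (s%:E + \sum_(i < n) tnth a i))%:E)%E.
Proof.
elim: n g s a => [|n IH] g s a gP s0 gs a0.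
  under eq_integral => z _.
    have -> : in_orthant a z = true by apply/forallP => -[].
    rewrite /tuple_sum big_ord0 addr0; over.
  rewrite /= integral_cst// [X in (_ * X)%E](_ : _ = 1%E) ?mule1; last exact: diracT.
  by rewrite big_ord0 (_ : (s%:E + 0)%E = s%:E)// adde0.
have [ge0 mono small slope] := gP.
pose F (z : n.+1.-tuple R) :=
  (if in_orthant a z then g n.+1 (s + tuple_sum z) else 0).
have FE z : F z = if in_orthant a z then extend0 (g n.+1) (s + tuple_sum z) else 0.
  rewrite /F; case: ifPn => // az; rewrite /extend0 ifT// ltr_wpDl//.
  exact: tuple_sum_gt0 az.
have mF : measurable_fun setT (EFin \o F).
  apply/measurable_EFinP; rewrite (funext FE).
  apply: measurable_fun_ifT => //; first exact: in_orthant_measurable.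
  apply: measurableT_comp.
    by apply: extend0_measurable => x y; exact: mono.
  by apply: measurable_funD => //; exact: tuple_sum_measurable.
have F0 z : (0 <= (F z)%:E)%E.
  rewrite lee_fin /F; case: ifPn => // az; apply: ge0 => //.
  by rewrite ltr_wpDl// (tuple_sum_gt0 _ _ _ az).
rewrite [LHS](integral_lebesgue_tupleS _ (EFin \o F))//.
set a' := [tuple of behead a].
have a'E i : tnth a' i = tnth a (lift ord0 i).
  by rewrite [in RHS](tuple_eta a) tnthS.
have a'0 i : (0 <= tnth a' i)%E by rewrite a'E.
set A := (\sum_(i < n) tnth a' i)%E.
have A0 : (0 <= A)%E by apply: sume_ge0.
have innerE (x : R) : (\int[lebesgue_tuple n]_t (F (tuple_cons n (x, t)))%:E =
    (if (0 < x)%R && (thead a <= x%:E)%E then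
       real_part_or0 (g 1%N) ((s + x)%R%:E + A) else 0%R)%:E)%E.
  under eq_integral do rewrite /F in_orthant_cons tuple_sum_cons addrA.
  case: ifPn => [/andP[x0 ax]|]/=; last by rewrite integral0.
  apply: (IH (fun k => g k.+1) (s + x)) => //.
  - exact: monotone_chain_shift.
  - by rewrite addr_ge0// ltW.
  - by left; rewrite ltr_wpDl.
under eq_integral do rewrite /= innerE.
have -> : (\sum_(i < n.+1) tnth a i = thead a + A)%E.
  by rewrite big_ord_recl; congr (_ + _)%E; apply: eq_bigr => i _; rewrite a'E.
clear innerE; clearbody A.
have := a0 ord0; rewrite -/(thead a).
(* As soon as one bound is infinite, both sides are 0. *)
move: (thead a) A A0 => [r| |]// [B| |]//; rewrite ?lee_fin => B0 r0;
  rewrite /= ?addey//= ?adde_eq_ninfty//=; last 3 first.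
- by under eq_integral do rewrite if_same; rewrite integral0.
- by under eq_integral do rewrite andbF; rewrite integral0.
- by under eq_integral do rewrite if_same; rewrite integral0.
under eq_integral do rewrite -addrA [_ + B]addrC addrA lee_fin.
rewrite (integral_orthant_side n g (s + B) r)//; last 2 first.
- by rewrite addr_ge0.
- have [sBr|] := ltP 0 (s + B + r).
    exact: monotone_chain_right_continuous gP _.
  (* A zero sum of nonnegative terms forces s = 0, which leaves the right-continuity alternative of
     the hypothesis. *)
  move=> h; have [s0' B0' r0'] : [/\ s = 0, B = 0 & r = 0] by split; lra.
  by case: gs; rewrite s0' ?ltxx// B0' r0' !addr0.
by rewrite [r + B]addrC addrA.
Qed.

End ChainIntegral.

(** * Generators, pseudo-inverses and the kernel formula *)

Section Generator.
Context {R : realType}.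
Variable psi : R -> R.
Hypothesis psi_gen : archimedean_generator psi.

Local Notation phi := (pseudo_inv psi).

Lemma generator0 : psi 0 = 1.
Proof. by case: psi_gen => -[]. Qed.

Lemma generator_ge0 x : 0 <= x -> 0 <= psi x.
Proof. by case: psi_gen => -[_ + _ _ _] _ x0 => /(_ x x0) /andP[]. Qed.

Lemma generator_le1 x : 0 <= x -> psi x <= 1.
Proof. by case: psi_gen => -[_ + _ _ _] _ x0 => /(_ x x0) /andP[]. Qed.

Lemma generator_nincr x y : 0 <= x -> x <= y -> psi y <= psi x.
Proof. by case: psi_gen => -[_ _ + _ _] _; exact. Qed.

Lemma generator_right_continuous z : 0 <= z -> right_continuous_at psi z.
Proof.
move=> z0 e e0; case: psi_gen => -[+ _ _ _ _] _.
move=> /continuous_within_itvcyP[ccont rcont].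
have : psi x @[x --> z^'+] --> psi z.
  move: z0; rewrite le_eqVlt => /predU1P[<-//|z0].
  by apply: cvg_at_right_filter; apply: ccont; rewrite in_itv/= z0.
move=> /cvgrPdist_lt /(_ e e0) [c /= c0 Hc].
exists c => // y zy yc; apply: Hc => //=.
by rewrite distrC ger0_norm; lra.
Qed.

Lemma pseudo_inv_ge0 y : (0 <= phi y)%E.
Proof. by apply: le_ereal_inf_tmp => z []. Qed.

(** The Galois connection between phi and psi, to which nearly every later fact about phi reduces.
    Right-continuity of psi gives one direction, the intermediate value theorem the other. *)
Lemma pseudo_inv_le y z : 0 <= y <= 1 -> 0 <= z ->
  (phi y <= z%:E)%E = (psi z <= y).
Proof.
move=> /andP[y0 y1] z0; apply/idP/idP => [|zy].
  move=> phiz; rewrite leNgt; apply/negP => yz.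
  (* psi stays above y a little beyond z, so the infimum, attained or not, is at least z + c / 2. *)
  have [c c0 Hc] := generator_right_continuous z z0 (psi z - y) ltac:(lra).
  suff : ((z + c / 2)%:E <= phi y)%E.
    by move=> /le_trans /(_ phiz); rewrite lee_fin; lra.
  apply: le_ereal_inf_tmp => -[w| |] []// ; rewrite ?leey// lee_fin => w0 /=.
  rewrite ltNge w0/= lee_fin => wy; rewrite leNgt; apply/negP => wz.
  have [wz'|zw] := leP w z; first by have := generator_nincr w z w0 wz'; lra.
  have := Hc w zw ltac:(lra); rewrite wy ger0_norm; first by lra.
  by lra.
have [||c] := @IVT R psi 0 z y z0.
- case: psi_gen => -[+ _ _ _ _] _; apply: continuous_subspaceW => x /=.
  by rewrite !in_itv/= => /andP[->].
- by rewrite generator0 ge_min zy orbT le_max y1.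
rewrite in_itv/= => /andP[c0 cz] psic; apply: (@le_trans _ _ c%:E).
  by apply: ge_ereal_inf; exists c%:E => //=; rewrite lee_fin ltNge c0.
by rewrite lee_fin.
Qed.

Lemma pseudo_inv_nincr y z : 0 <= y -> y <= z -> z <= 1 -> (phi z <= phi y)%E.
Proof.
move=> y0 yz z1; move: (pseudo_inv_ge0 y) (pseudo_inv_le y).
case: (phi y) => [r|_ _|//]; last by rewrite leey.
rewrite lee_fin => r0 H; rewrite pseudo_inv_le//; last first.
  by rewrite z1 andbT (le_trans y0).
by apply: (le_trans _ yz); rewrite -H// y0 (le_trans yz).
Qed.

Lemma pseudo_inv1 : phi 1 = 0%E.
Proof.
apply: le_anti; rewrite pseudo_inv_ge0 andbT pseudo_inv_le//.
  by rewrite generator0.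
by rewrite ler01 lexx.
Qed.

Lemma pseudo_inv_eq0 y : 0 <= y <= 1 -> (phi y == 0%E) = (1 <= y).
Proof.
by move=> y01; rewrite eq_le pseudo_inv_ge0 andbT pseudo_inv_le// generator0.
Qed.

Lemma pseudo_inv_gt0 : (0 < phi 0)%E.
Proof.
rewrite lt_neqAle pseudo_inv_ge0 andbT eq_sym pseudo_inv_eq0 ?lexx ?ler01//.
by rewrite ler10.
Qed.

Lemma pseudo_inv_generator z : 0 <= z -> (z%:E <= phi 0)%E -> phi (psi z) = z%:E.
Proof.
move=> z0 zphi; have p01 : 0 <= psi z <= 1.
  by rewrite generator_ge0// generator_le1.
apply: le_anti; rewrite pseudo_inv_le// lexx/= leNgt; apply/negP => zlt.
have := pseudo_inv_ge0 (psi z).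
have [r rE] : exists r, phi (psi z) = r%:E.
  by move: zlt (pseudo_inv_ge0 (psi z)); case: (phi (psi z)) => // r; exists r.
move: zlt; rewrite rE lte_fin lee_fin => rz r0.
(* Strict decrease is stated up to [gen_zero psi], which is by definition the same infimum as
   [phi 0]. *)
have : psi z < psi r by case: psi_gen => _; apply.
by rewrite ltNge -pseudo_inv_le// rE lexx.
Qed.

(** For r >= 0, r < phi(y) means y < psi(r), an open condition on y. *)
Lemma pseudo_inv_right_gt (r y : R) : 0 <= y < 1 -> (r%:E < phi y)%E ->
  exists2 c : R, 0 < c & forall t, y < t -> t < y + c -> t <= 1 -> (r%:E < phi t)%E.
Proof.
move=> /andP[y0 y1]; have [r0|r0] := leP 0 r; last first.
  move=> _; exists 1 => // t _ _ _.
  by apply: lt_le_trans (pseudo_inv_ge0 t); rewrite lte_fin.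
have y01 : 0 <= y <= 1 by rewrite y0 ltW.
rewrite ltNge pseudo_inv_le// -ltNge => ypsi.
exists (psi r - y) => [|t yt ty t1]; first by rewrite subr_gt0.
rewrite ltNge pseudo_inv_le//; last by apply/andP; split; lra.
by rewrite -ltNge; lra.
Qed.

Lemma sum_phi_ge0 n (x : n.-tuple R) : (0 <= sum_phi psi x)%E.
Proof. by apply: sume_ge0 => i _; exact: pseudo_inv_ge0. Qed.

(** Turns the test M(x) = 1 of the kernel into a condition on the sum S of the phi(x_i), so that the
    kernel depends on x through S alone. *)
Lemma sum_phi_eq0 n (x : n.-tuple R) : cubeI n x ->
  (sum_phi psi x == 0%E) = (minM x == 1).
Proof.
move=> x01; rewrite seq_psume_eq0; last by move=> i _; exact: pseudo_inv_ge0.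
rewrite [RHS]eq_le bigmin_le_id/=.
apply/allP/idP => [H|/bigmin_geP[_ H] i _]; last first.
  by rewrite /= pseudo_inv_eq0 ?H//; exact: x01.
apply/bigmin_geP; split => // i _.
by have := H i (mem_index_enum i); rewrite /= pseudo_inv_eq0//; exact: x01.
Qed.

End Generator.

(** * The kernel formula as a distribution function in y *)

Section KernelFormula.
Context {R : realType}.
Variables (N : nat) (psi : R -> R).
Hypothesis psi_gen : archimedean_generator psi.
Hypothesis psi_dm : d_monotone N.+2 psi.

Local Notation phi := (pseudo_inv psi).
Local Notation g := (generator_chain N psi).
Local Notation q := (generator_chain N psi N.+1).
Local Notation qe := (real_part_or0 (generator_chain N psi N.+1)).

Lemma archimedean_chain : monotone_chain N.+1 g.
Proof.
apply: generator_chainP => //; first exact: generator_ge0.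
by case: psi_gen => -[].
Qed.

Lemma generator_chain0 : g 0 = psi.
Proof.
by apply/funext => x; rewrite /generator_chain leq0n expr0 mul1r derive1n0.
Qed.

Lemma top_left_continuous (x e : R) : 0 < x -> 0 < e ->
  exists2 c : R, 0 <= c < x & forall u : R, c < u -> u <= x -> q u < q x + e.
Proof.
apply: generator_chain_left_continuous => //; first exact: generator_ge0.
by case: psi_gen => -[].
Qed.

Lemma generator_chain_eq0 p : phi 0 = p%:E ->
  (forall x : R, p < x -> q x = 0) /\ (forall x : R, p <= x -> g N x = 0).
Proof.
move=> pE; have p0 : 0 < p by rewrite -lte_fin -pE pseudo_inv_gt0.
have psi0 x : p <= x -> g 0 x = 0.
  move=> px; have x0 : 0 <= x by rewrite (le_trans (ltW p0)).
  rewrite generator_chain0; apply: le_anti; rewrite generator_ge0// andbT.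
  by rewrite -pseudo_inv_le ?lexx ?ler01// pE lee_fin.
have H := monotone_chain_eq0 _ _ archimedean_chain p p0 psi0.
split => x; first by have [+ _] := H N.+1 (leqnn _); exact.
have [H1 /(_ (ltnSn N)) H2] := H N (leqnSn N).
by rewrite le_eqVlt => /predU1P[<-|/H1].
Qed.

Lemma top_gt0 (r : R) : 0 < r -> (r%:E < phi 0)%E -> 0 < q r.
Proof.
move=> r0 rphi; apply: (monotone_chain_gt0 _ _ archimedean_chain) => //.
rewrite generator_chain0 ltNge -pseudo_inv_le ?lexx ?ler01//; last exact: ltW.
by rewrite -ltNge.
Qed.

Lemma real_part_or0_topE z : qe z = (-1) ^+ N.+1 * Dl_ext N.+2 psi z.
Proof.
case: z => [r| |] /=; rewrite ?mulr0//.
by rewrite /generator_chain ltnn !subSS subn0.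
Qed.

(** If y < f0(x), then S + phi(y) lies strictly beyond phi(0), where q vanishes, so the quotient
    produces the value 0 by itself. The signs (-1)^(N+1) cancel in the quotient. *)
Lemma KcdfE (x : N.+1.-tuple R) y : cubeI N.+1 x -> 0 <= y <= 1 ->
  Kcdf N.+2 psi x y =
  if (sum_phi psi x == 0%E) || (phi 0 <= sum_phi psi x)%E then 1
  else qe (sum_phi psi x + phi y)%E / qe (sum_phi psi x).
Proof.
move=> x01 y01; rewrite /Kcdf /f0 /inL0 -(sum_phi_eq0 psi)//.
case: ifPn => //; rewrite negb_or -ltNge => /andP[Sneq0 Sphi].
rewrite [(_ <= _)%E]leNgt Sphi/= !real_part_or0_topE.
rewrite -mulf_div divff ?mul1r ?signr_eq0//; case: ifPn => // yf0.
have Sfin : sum_phi psi x \is a fin_num.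
  by rewrite ge0_fin_numE ?sum_phi_ge0// (lt_le_trans Sphi) ?leey.
have := sum_phi_ge0 psi _ x; move: Sneq0 Sphi yf0 Sfin.
case: (sum_phi psi x) => [r| |]// rneq0 rphi yf0 _; rewrite lee_fin => r0.
apply/eqP; rewrite eq_sym mulf_eq0; apply/orP; left.
have := real_part_or0_topE (r%:E + phi y)%E.
suff -> : qe (r%:E + phi y)%E = 0.
  by move=> /esym/eqP; rewrite mulf_eq0 signr_eq0.
have := @generator_chain_eq0; move: rphi yf0.
case pE : (phi 0) => [p| |]//=; last by move: y01 => /andP[y0 _] _; rewrite ltNge y0.
rewrite lte_fin subr_lt0 => rp; rewrite [p < r]ltNge (ltW rp)/= => yf0 /(_ p erefl)[+ _].
have pr0 : 0 <= p - r by rewrite subr_ge0 ltW.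
move: yf0; rewrite ltNge -pseudo_inv_le// -ltNge.
case: (phi y) => [s| |]//=; rewrite lte_fin => ps; apply; lra.
Qed.

(** phi and q are both nonincreasing, so q(S + phi(y)) increases with y and reaches q(S) at y = 1.
    For t > y the argument S + phi(t) approaches S + phi(y) from the left, so left-continuity of q
    gives right-continuity in y. *)
Lemma Kcdf_is_df (x : N.+1.-tuple R) : cubeI N.+1 x ->
  is_df_on_I (Kcdf N.+2 psi x).
Proof.
move=> x01; set F := Kcdf _ _ _.
have y01 y : 0 <= y -> y <= 1 -> 0 <= y <= 1 by move=> -> ->.
have FE y : 0 <= y -> y <= 1 -> F y =
    if (sum_phi psi x == 0%E) || (phi 0 <= sum_phi psi x)%E then 1
    else qe (sum_phi psi x + phi y)%E / qe (sum_phi psi x).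
  by move=> y0 y1; rewrite /F KcdfE// y0.
have right_eq (G : R -> R) y : 0 <= y < 1 ->
    (forall t : R, 0 <= t -> t <= 1 -> F t = G t) ->
    G t @[t --> y^'+] --> G y -> F t @[t --> y^'+] --> F y.
  move=> /andP[y0 y1] FG Gy; rewrite FG//; last exact: ltW.
  apply: cvg_trans Gy; apply: near_eq_cvg; near=> t; rewrite FG//.
    by apply: (le_trans y0); near: t; exact: nbhs_right_ge.
  by near: t; exact: nbhs_right_le.
have [C|C] := boolP ((sum_phi psi x == 0%E) || (phi 0 <= sum_phi psi x)%E).
  have {}FE (y : R) : 0 <= y -> y <= 1 -> F y = 1 by move=> *; rewrite FE// C.
  split => [y /andP[y0 y1]|y z y0 yz z1|y y0|].
  - by rewrite FE// ler01 lexx.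
  - by rewrite !FE//; lra.
  - by apply: (right_eq (cst 1)) => //; exact: cvg_cst.
  - exact: FE.
have {}FE (y : R) : 0 <= y -> y <= 1 ->
    F y = qe (sum_phi psi x + phi y)%E / qe (sum_phi psi x).
  by move=> *; rewrite FE// (negbTE C).
move: C; rewrite negb_or -ltNge => /andP[S0 Sphi].
have Sfin : sum_phi psi x \is a fin_num.
  by rewrite ge0_fin_numE ?sum_phi_ge0// (lt_le_trans Sphi) ?leey.
have := sum_phi_ge0 psi _ x; move: S0 Sphi Sfin FE.
case: (sum_phi psi x) => [r| |]//; rewrite eqe lee_fin => rneq0 rphi _ FE r_ge0.
have r0 : 0 < r by rewrite lt_neqAle eq_sym rneq0.
have qr0 := top_gt0 r r0 rphi.
have [ge0 mono small _] := archimedean_chain.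
pose H y := qe (r%:E + phi y)%E.
have H_ge0 y : 0 <= H y.
  rewrite /H; have := pseudo_inv_ge0 psi y; case: (phi y) => [s| |]//=.
  by rewrite lee_fin => s0; apply: ge0 => //; lra.
have H_le y : H y <= q r.
  rewrite /H; have := pseudo_inv_ge0 psi y; case: (phi y) => [s| |]//= => [|_].
    by rewrite lee_fin => s0; apply: mono => //; lra.
  exact: ltW.
have H_mono y z : 0 <= y -> y <= z -> z <= 1 -> H y <= H z.
  move=> y0 yz z1; have := pseudo_inv_nincr _ psi_gen y z y0 yz z1.
  have := pseudo_inv_ge0 psi y; have := pseudo_inv_ge0 psi z.
  have := H_ge0 z; rewrite /H.
  case: (phi y) => [s| |]//; case: (phi z) => [t| |]//=.
  by rewrite !lee_fin => _ t0 s0 ts; apply: mono => //; lra.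
split => [y /andP[y0 y1]|y z y0 yz z1|y /andP[y0 y1]|].
- rewrite FE//; apply/andP; split.
    by apply: divr_ge0; [exact: H_ge0|exact: ltW].
  by rewrite ler_pdivrMr// mul1r; exact: H_le.
- by rewrite !FE//; [rewrite ler_pM2r ?invr_gt0// H_mono|lra..].
- apply: (right_eq (fun t => H t / q r)); first by rewrite y0.
    by move=> t t0 t1; rewrite FE.
  apply: cvgMl; apply/cvgrPdist_lt => e e0.
  suff [c c0 Hc] : exists2 c : R, 0 < c & forall t, y < t -> t < y + c ->
      t <= 1 -> H t < H y + e.
    near=> t; have yt : y < t by near: t; exact: nbhs_right_gt.
    have t1 : t <= 1 by near: t; exact: nbhs_right_le.
    have := H_mono y t y0 (ltW yt) t1.
    have : H t < H y + e.
      by apply: Hc => //; near: t; apply: nbhs_right_lt; rewrite ltrDl.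
    by rewrite ltr_norml; lra.
  have yy : 0 <= y < 1 by rewrite y0.
  have yphi := pseudo_inv_right_gt _ psi_gen _ y yy.
  have := pseudo_inv_nincr _ psi_gen y.
  have := pseudo_inv_ge0 psi y.
  rewrite /H; case pE : (phi y) yphi => [p| |]// yphi.
    rewrite lee_fin => p0 anti.
    have rp0 : 0 < r + p by lra.
    have [c /andP[c0 crp] Hc] := top_left_continuous (r + p) e rp0 e0.
    (* phi(t) > c - r places r + phi(t) in ]c, r + p], where the left-continuity estimate
       applies. *)
    have [//|b b0 Hb] := yphi (c - r); first by rewrite lte_fin; lra.
    exists b => // t yt tb t1.
    have := Hb t yt tb t1; have := anti t y0 (ltW yt) t1.
    case: (phi t) => [s| |]//=; rewrite lee_fin lte_fin => sp cs.
    by apply: Hc; lra.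
  (* Here phi(y) = +oo and H y = 0, so decay of q at infinity replaces left-continuity. *)
  move=> _ _; have [M M0 HM] := small N.+1 e (leqnn _) e0.
  have [//|b b0 Hb] := yphi M; first by rewrite ltry.
  exists b => // t yt tb t1; have := Hb t yt tb t1.
  case: (phi t) => [s| |]//=; rewrite ?lte_fin add0r// => Ms.
  by apply: HM; lra.
- by rewrite FE// pseudo_inv1// adde0/= divff// gt_eqF.
Unshelve. all: by end_near. Qed.

End KernelFormula.

(** * From distribution functions on the unit interval to probability measures *)

Section DistributionFunction.
Context {R : realType}.
Variable F : R -> R.
Hypothesis F_df : is_df_on_I F.

Definition extended_df (t : R) : R := if t < 0 then 0 else if t < 1 then F t else 1.

Let extended_df_nondecreasing : nondecreasing_fun extended_df.
Proof.
case: F_df => F01 F_mono _ F1 s t st; rewrite /extended_df.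
have [s0|s0] := ltP s 0.
  case: ltP => t0 //; case: ltP => // t1.
  by have := F01 t; rewrite t0 ltW// => /(_ isT)/andP[].
rewrite [t < 0]ltNge (le_trans s0 st)/=.
have [s1|s1] := ltP s 1; last by rewrite ltNge (le_trans s1 st).
case: ltP => t1; first by apply: F_mono => //; exact: ltW.
by have := F01 s; rewrite s0 ltW// => /(_ isT)/andP[].
Qed.

Let extended_df_right_continuous : right_continuous extended_df.
Proof.
case: F_df => F01 F_mono F_right F1 y.
have [y0|y0] := ltP y 0.
  rewrite {2}/extended_df y0.
  apply: (@cvg_trans _ (cst 0 t @[t --> y^'+])); last exact: cvg_cst.
  apply: near_eq_cvg; near=> t.
  have t0 : t < 0 by near: t; exact: nbhs_right_lt.
  by rewrite /extended_df t0.
have [y1|y1] := ltP y 1; rewrite {2}/extended_df ltNge y0/=.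
  rewrite y1; have := F_right y; rewrite y0 y1 => /(_ isT); apply: cvg_trans.
  apply: near_eq_cvg; near=> t.
  have yt : y <= t by near: t; exact: nbhs_right_ge.
  have t1 : t < 1 by near: t; exact: nbhs_right_lt.
  by rewrite /extended_df ltNge (le_trans y0 yt)/= t1.
rewrite ltNge y1/=.
apply: (@cvg_trans _ (cst 1 t @[t --> y^'+])); last exact: cvg_cst.
apply: near_eq_cvg; near=> t.
have yt : y <= t by near: t; exact: nbhs_right_ge.
by rewrite /extended_df ltNge (le_trans y0 yt)/= ltNge (le_trans y1 yt).
Unshelve. all: by end_near. Qed.

HB.instance Definition _ := isCumulative.Build R _ R extended_df
  extended_df_nondecreasing extended_df_right_continuous.

Let extended_df_cvgNy : extended_df @ -oo --> (0 : R).
Proof.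
apply: (@cvg_trans _ (cst 0 @ -oo)); last exact: cvg_cst.
apply: near_eq_cvg; near=> t.
have t0 : t < 0 by near: t; apply: nbhs_ninfty_lt; exact: num_real.
by rewrite /extended_df t0.
Unshelve. all: by end_near. Qed.

Let extended_df_cvgy : extended_df @ +oo --> (1 : R).
Proof.
apply: (@cvg_trans _ (cst 1 @ +oo)); last exact: cvg_cst.
apply: near_eq_cvg; near=> t.
have t1 : 1 <= t by near: t; apply: nbhs_pinfty_ge; exact: num_real.
by rewrite /extended_df ltNge (le_trans ler01 t1)/= ltNge t1.
Unshelve. all: by end_near. Qed.

HB.instance Definition _ := isCumulativeBounded.Build R 0 1 extended_df
  extended_df_cvgNy extended_df_cvgy.

(* The Stieltjes measure lives on the copy [measurableTypeR R] of [R]; its image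
   under the identity is a measure on [R]. *)
Let idTR : measurableTypeR R -> R := idfun.

#[local] HB.instance Definition _ :=
  @isMeasurableFun.Build _ _ _ _ idTR (@measurable_id _ _ setT).

Lemma df_probability : exists P : probability R R,
  P (~` unitI) = 0%E /\ forall y, unitI y -> P `[0, y] = (F y)%:E.
Proof.
pose P : probability R R :=
  distribution (lebesgue_stieltjes_measure extended_df) idTR.
exists P.
have PNy r : P `]-oo, r] = (extended_df r)%:E.
  exact: (@cdf_lebesgue_stieltjes_id R extended_df r).
(* There may be an atom F(0) at 0, so the open ray is not read off from ]-oo, 0] but exhausted by
   closed rays with negative endpoints. *)
have Pneg : P `]-oo, 0[ = 0%E.
  pose U (k : nat) : set R := `]-oo, - k.+1%:R^-1].
  have UE : `]-oo, 0[%classic = \bigcup_k U k.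
    apply/seteqP; split => x /=; rewrite in_itv/=; last first.
      move=> [k _]; rewrite /U/= in_itv/= => /le_lt_trans; apply.
      by rewrite oppr_lt0 invr_gt0.
    move=> x0; exists (Num.truncn (- x)^-1) => //; rewrite /U/= in_itv/=.
    rewrite lerNr ltW// invf_plt ?posrE ?oppr_gt0//.
    exact: truncnS_gt.
  rewrite UE; apply/esym; apply: cvg_unique (_ : P (U k) @[k --> \oo] --> _) => //.
    rewrite (_ : (fun k => _) = cst 0%E); first exact: cvg_cst.
    apply/funext => k; have k0 : - k.+1%:R^-1 < 0 :> R by rewrite oppr_lt0 invr_gt0.
    by rewrite /U PNy/= /extended_df k0.
  apply: nondecreasing_cvg_mu => //.
  - by move=> k; exact: measurable_itv.
  - by apply: bigcup_measurable => k _; exact: measurable_itv.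
  - move=> j k jk; apply/subsetPset => x; rewrite /U/= !in_itv/= => /le_trans; apply.
    by rewrite lerN2 lef_pV2 ?posrE// ler_nat ltnS.
have Pitv y : 0 <= y -> P `[0, y] = (extended_df y)%:E.
  move=> y0; rewrite -PNy -[LHS]add0e -[X in (X + _)%E = _]Pneg -measureU//.
    congr (P _); apply/seteqP; split => x /=; rewrite !in_itv/=.
      by move=> [/ltW x0|/andP[]//]; exact: le_trans y0.
    by move=> xy; have [x0|x0] := ltP x 0; [left|right].
  apply/seteqP; split => x //= -[]; rewrite !in_itv/= => x0 /andP[].
  by rewrite leNgt x0.
split; last first.
  move=> y /andP[y0 y1]; rewrite Pitv// /extended_df ltNge y0/=.
  case: ltP => // y1'; have -> : y = 1 by apply: le_anti; rewrite y1.
  by case: F_df => _ _ _ ->.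
have -> : ~` unitI = ~` `[0, 1]%classic :> set R.
  by congr (~` _); apply/seteqP; split => x /=; rewrite in_itv.
rewrite probability_setC; last exact: measurable_itv.
by rewrite Pitv// /extended_df ltNge ler01/= ltxx subee.
Qed.


End DistributionFunction.

(** * Uniqueness and disintegration of measures *)

Section MeasureTheory.
Context {R : realType}.

Lemma measure_setI_conull d (T : measurableType d) (m : {measure set T -> \bar R})
    (C B : set T) : measurable C -> m (~` C) = 0%E -> measurable B ->
  m B = m (B `&` C).
Proof.
move=> mC mC0 mB; have mCC := measurableC mC.
rewrite -[in LHS](setIT B) -(setUv C) setIUr measureU.
- rewrite [X in (_ + X)%E](_ : _ = 0%E) ?adde0//.
  apply/eqP; rewrite -measure_le0 -mC0 le_measure ?inE//.
  exact: measurableI.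
- exact: measurableI.
- exact: measurableI.
- by rewrite setIACA setICr setI0.
Qed.

Definition closed_rays : set (set R) := [set A | exists y, A = `]-oo, y]%classic].

Lemma measurable_closed_rays :
  (@measurable _ R : set (set R)) = <<s closed_rays >>.
Proof.
rewrite eqEsubset; split; last first.
  apply: smallest_sub; first exact: sigma_algebra_measurable.
  by move=> _ [y ->]; exact: measurable_itv.
rewrite [X in X `<=` _](_ : _ = <<s @RGenOInfty.G R >>); last first.
  exact: RGenOInfty.measurableE.
apply: smallest_sub.
  exact: smallest_sigma_algebra.
move=> _ [y ->]; rewrite -setCitvl; apply: sigma_algebraC.
by apply: sub_sigma_algebra; exists y.
Qed.

Lemma closed_rays_setI : setI_closed closed_rays.
Proof.
move=> _ _ [x ->] [y ->]; exists (Num.min x y).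
by apply/seteqP; split => z /=; rewrite !in_itv/= le_min => /andP.
Qed.

Lemma bigcup_closed_rays : \bigcup_k `]-oo, k%:R]%classic = [set: R].
Proof.
apply/seteqP; split => // x _; exists (Num.truncn `|x|).+1 => //=.
rewrite in_itv/=; apply: (le_trans (ler_norm _)); apply/ltW.
exact: truncnS_gt.
Qed.

Definition lower_box {n} (c : n.-tuple R) : set (n.-tuple R) :=
  [set t | forall i, tnth t i <= tnth c i].

Lemma lower_box_measurable n (c : n.-tuple R) : measurable (lower_box c).
Proof.
rewrite (_ : lower_box c = \bigcap_(i in [set: 'I_n])
    (fun t => tnth t i) @^-1` `]-oo, tnth c i]%classic).
  apply: fin_bigcap_measurable => // i _.
  by rewrite -[X in measurable X]setTI; apply: measurable_tnth.
apply/seteqP; split => t H i; first by move=> _; rewrite /= in_itv/=; exact: H.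
by have := H i Logic.I; rewrite /= in_itv.
Qed.

Lemma measurable_lower_box n :
  (@measurable _ (n.-tuple R) : set (set (n.-tuple R))) =
  <<s range (@lower_box n) >>.
Proof.
rewrite eqEsubset; split; last first.
  apply: smallest_sub; first exact: sigma_algebra_measurable.
  by move=> _ [c _ <-]; exact: lower_box_measurable.
apply: smallest_sub; first exact: smallest_sigma_algebra.
move=> A; rewrite -bigcup_seq => -[i _ [B mB <-]].
pose T := g_sigma_algebraType (range (@lower_box n)).
suff mi : measurable_fun [set: T] (fun t : T => tnth (t : n.-tuple R) i : R).
  exact: mi.
apply: (measurability _ measurable_closed_rays) => _ [_ [y ->] <-].
rewrite setTI.
(* The half-space t_i <= y is the increasing union of boxes whose other sides end at k. *)
pose c (k : nat) := [tuple if j == i then y else k%:R | j < n].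
rewrite (_ : _ @^-1` _ = \bigcup_k lower_box (c k)).
  apply: bigcupT_measurable => k; apply: sub_sigma_algebra.
  by exists (c k).
apply/seteqP; split => t /=; rewrite in_itv/=; last first.
  by move=> [k _ /(_ i)]; rewrite tnth_mktuple eqxx.
move=> ty; exists (\max_j (Num.truncn `|tnth t j|).+1)%N => // j.
rewrite tnth_mktuple; case: eqP => [->//|_].
apply: (le_trans (ler_norm _)); apply/ltW/(lt_le_trans (truncnS_gt _)).
by rewrite ler_nat (leq_bigmax j).
Qed.

Lemma cubeI_measurable n : measurable (cubeI n : set (n.-tuple R)).
Proof.
rewrite (_ : cubeI n = \bigcap_(i in [set: 'I_n])
    (fun t => tnth t i) @^-1` `[0, 1]%classic).
  apply: fin_bigcap_measurable => // i _.
  by rewrite -[X in measurable X]setTI; apply: measurable_tnth.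
apply/seteqP; split => t H i; first by move=> _; rewrite /= in_itv/=; exact: H.
by have := H i Logic.I; rewrite /= in_itv.
Qed.

(** Boxes with corner outside the cube reduce to the known ones: a negative coordinate makes the box
    miss the cube, and coordinates above 1 can be clipped to 1. *)
Lemma cube_measure_unique n (m1 m2 : {measure set (n.-tuple R) -> \bar R}) :
  (m1 setT < +oo)%E -> m1 (~` cubeI n) = 0%E -> m2 (~` cubeI n) = 0%E ->
  (forall c, cubeI n c -> m1 (lower_box c) = m2 (lower_box c)) ->
  forall A, measurable A -> m1 A = m2 A.
Proof.
move=> m1fin m1C m2C m12 A mA.
have mC := cubeI_measurable n.
have restr (m : {measure set (n.-tuple R) -> \bar R}) B :
    m (~` cubeI n) = 0%E -> measurable B -> m B = m (B `&` cubeI n).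
  by move=> mC0 mB; exact: measure_setI_conull.
apply: (measure_unique (range (@lower_box n))
  (fun k => lower_box [tuple k%:R | _ < n])) => //.
- exact: measurable_lower_box.
- move=> _ _ [a _ <-] [b _ <-].
  exists [tuple Num.min (tnth a i) (tnth b i) | i < n] => //.
  apply/seteqP; split => t /=.
    by move=> H; split => i; have := H i; rewrite tnth_mktuple le_min => /andP[].
  by move=> [Ha Hb] i; rewrite tnth_mktuple le_min Ha Hb.
- apply/seteqP; split => // t _.
  exists (\max_j (Num.truncn `|tnth t j|).+1)%N => // j.
  rewrite tnth_mktuple.
  apply: (le_trans (ler_norm _)); apply/ltW/(lt_le_trans (truncnS_gt _)).
  by rewrite ler_nat (leq_bigmax j).
- move=> _ [c _ <-].
  rewrite (restr m1)//; last exact: lower_box_measurable.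
  rewrite (restr m2)//; last exact: lower_box_measurable.
  have [c0|] := pselect (forall i, 0 <= tnth c i); last first.
    move=> /existsNP[i /negP]; rewrite -ltNge => ci.
    rewrite (_ : _ `&` _ = set0) ?measure0//.
    apply/seteqP; split => // t [/(_ i) tc /(_ i) /andP[t0 _]].
    by have := le_lt_trans (le_trans t0 tc) ci; rewrite ltxx.
  pose c' := [tuple Num.min (tnth c i) 1 | i < n].
  have c'01 : cubeI n c'.
    by move=> i; rewrite tnth_mktuple le_min c0 ler01 ge_min lexx orbT.
  have -> : lower_box c `&` cubeI n = lower_box c' `&` cubeI n.
    apply/seteqP; split => t [H C]; split => // i.
      by rewrite tnth_mktuple le_min H; have /andP[] := C i.
    by have := H i; rewrite tnth_mktuple le_min => /andP[].
  rewrite -(restr m1)//; last exact: lower_box_measurable.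
  by rewrite -(restr m2)//; [exact: m12|exact: lower_box_measurable].
- move=> k; apply: le_lt_trans m1fin; rewrite le_measure ?inE//.
  exact: lower_box_measurable.
Qed.

End MeasureTheory.

(** * Measures on a product with the real line, kernels and densities *)

Section Disintegration.
Context {R : realType}.

Lemma measurable_prod_closed_rays d (X : measurableType d) :
  (@measurable _ (X * R)%type : set (set (X * R))) =
  <<s [set A `*` B | A in measurable & B in @closed_rays R] >>.
Proof.
set G := (X in <<s X >>).
rewrite eqEsubset; split; last first.
  apply: smallest_sub; first exact: sigma_algebra_measurable.
  move=> _ [A mA [_ [y ->] <-]]; apply: measurableX => //.
rewrite measurable_prod_measurableType.
apply: smallest_sub; first exact: smallest_sigma_algebra.
move=> _ [A mA [B mB <-]].
pose T := g_sigma_algebraType G.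
rewrite (_ : A `*` B = (A `*` setT) `&` (snd @^-1` B)); last first.
  by apply/seteqP; split => -[x y] /=; tauto.
apply: (@measurableI _ T).
  rewrite -bigcup_closed_rays setX_bigcupr.
  apply: (@bigcupT_measurable _ T) => k; apply: sub_sigma_algebra.
  by exists A => //; exists `]-oo, k%:R]%classic => //; exists k%:R.
suff msnd : measurable_fun [set: T] (snd : T -> R).
  by rewrite -[X in measurable X]setTI; exact: msnd.
apply: (measurability _ measurable_closed_rays) => _ [_ [y ->] <-].
apply: sub_sigma_algebra; exists setT => //; exists `]-oo, y]%classic.
  by exists y.
by apply/seteqP; split => -[x z] /=; tauto.
Qed.

Lemma prod_measure_unique d (X : measurableType d)
    (m1 m2 : {measure set (X * R) -> \bar R}) : (m1 setT < +oo)%E ->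
  (forall A y, measurable A -> m1 (A `*` `]-oo, y]) = m2 (A `*` `]-oo, y])) ->
  forall A, measurable A -> m1 A = m2 A.
Proof.
move=> m1fin m12; apply: (measure_unique
  [set A `*` B | A in measurable & B in @closed_rays R]
  (fun k => setT `*` `]-oo, k%:R]%classic)) => //.
- exact: measurable_prod_closed_rays.
- move=> _ _ [A1 mA1 [B1 rB1 <-]] [A2 mA2 [B2 rB2 <-]].
  exists (A1 `&` A2); first exact: measurableI.
  by exists (B1 `&` B2); [exact: closed_rays_setI|rewrite setXI].
- by move=> k; exists setT => //; exists `]-oo, k%:R]%classic => //; exists k%:R.
- by rewrite -setX_bigcupr bigcup_closed_rays setXTT.
- by move=> _ [A mA [_ [y ->] <-]]; exact: m12.
- move=> k; apply: le_lt_trans m1fin; rewrite le_measure ?inE//.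
  exact: measurableX.
Qed.

(** Dynkin argument: the sets E with x |-> K x E measurable form a lambda-system, and the closed
    rays are stable under intersection. *)
Lemma measurable_kernel_closed_rays d (X : measurableType d)
    (K : X -> probability R R) :
  (forall y, measurable_fun setT (fun x => K x `]-oo, y])) ->
  forall E, measurable E -> measurable_fun setT (fun x => K x E).
Proof.
move=> mK E mE.
pose H := [set E : set R | measurable E /\ measurable_fun setT (fun x => K x E)].
suff : <<s @closed_rays R >> `<=` H.
  by move=> /(_ E); rewrite -measurable_closed_rays => /(_ mE)[].
apply: lambda_system_subset => //; first exact: closed_rays_setI.
- split => //.
  + split => //; rewrite (_ : (fun _ => _) = cst 1%E); first exact: measurable_cst.
    by apply/funext => x; exact: probability_setT.
  + move=> A B BA [mA mKA] [mB mKB]; split; first exact: measurableD.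
    rewrite (_ : (fun _ => _) = (fun x => K x A - K x B)%E).
      exact: emeasurable_funB.
    apply/funext => x; rewrite measureD// ?setIidr//.
    by rewrite (le_lt_trans (probability_le1 _ mA)) ?ltry.
  + move=> F ndF HF; split.
      by apply: bigcupT_measurable => k; have [] := HF k.
    apply: (emeasurable_fun_cvg (fun k x => K x (F k))) => [k|x _].
      by have [] := HF k.
    apply: nondecreasing_cvg_mu => // [k|]; first by have [] := HF k.
    by apply: bigcupT_measurable => k; have [] := HF k.
- by move=> _ [y ->]; split => //; exact: mK.
Qed.

Section KernelMeasure.
Context d (X : measurableType d).
Variables (m : {measure set X -> \bar R}) (K : X -> probability R R).
Hypothesis mK : forall E, measurable E -> measurable_fun setT (fun x => K x E).

Let K_uub : measure_fam_uub (fun x => K x : {measure set R -> \bar R}).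
Proof.
exists 2 => x; rewrite [X in (X < _)%E](_ : _ = 1%E) ?lte_fin ?ltr1n//.
exact: probability_setT.
Qed.

Let kernel_of : X -> {measure set R -> \bar R} := fun x => K x.

HB.instance Definition _ := isKernel.Build _ _ _ _ _ kernel_of mK.

HB.instance Definition _ := Kernel_isFinite.Build _ _ _ _ _ kernel_of K_uub.

Lemma measurable_kernel_xsection A : measurable A ->
  measurable_fun setT (fun x => K x (xsection A x)).
Proof.
by move=> mA; apply: (measurable_fun_xsection_finite_kernel kernel_of); rewrite inE.
Qed.

Definition kernel_measure (A : set (X * R)) : \bar R :=
  (\int[m]_x K x (xsection A x))%E.

Let kernel_measure0 : kernel_measure set0 = 0%E.
Proof. by apply: integral0_eq => x _; rewrite xsection0 measure0. Qed.

Let kernel_measure_ge0 A : (0 <= kernel_measure A)%E.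
Proof. by apply: integral_ge0. Qed.

Let kernel_measure_sigma_additive : semi_sigma_additive kernel_measure.
Proof.
move=> F mF tF mUF.
rewrite [X in _ --> X](_ : _ = (\sum_(n <oo) kernel_measure (F n))%E).
  by apply/cvg_closeP; split; [exact: is_cvg_nneseries|rewrite closeE].
rewrite -integral_nneseries//; last by move=> n; exact: measurable_kernel_xsection.
apply: eq_integral => x _; apply/esym/cvg_lim => //=; rewrite xsection_bigcup.
apply: (measure_sigma_additive _ (trivIset_xsection tF)) => n.
exact: measurable_xsection.
Qed.

HB.instance Definition _ := isMeasure.Build _ _ _ kernel_measure
  kernel_measure0 kernel_measure_ge0 kernel_measure_sigma_additive.

Lemma kernel_disintegration (mu : {measure set (X * R) -> \bar R}) :
  (mu setT < +oo)%E ->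
  (forall A y, measurable A ->
    mu (A `*` `]-oo, y]) = (\int[m]_(x in A) K x `]-oo, y])%E) ->
  forall A, measurable A -> mu A = (\int[m]_x K x (xsection A x))%E.
Proof.
move=> mufin H A mA.
apply: (prod_measure_unique _ _ mu kernel_measure) => // B y mB.
rewrite H// /kernel_measure [LHS]integral_mkcond; apply: eq_integral => x _.
rewrite patchE; case: ifPn => xB; first by rewrite in_xsectionX.
by rewrite notin_xsectionX// measure0.
Qed.

End KernelMeasure.

Section Density.
Context d (T : measurableType d).
Variables (m : {measure set T -> \bar R}) (w : T -> \bar R).
Hypothesis mw : measurable_fun setT w.
Hypothesis w0 : forall x, (0 <= w x)%E.

Definition density_measure (A : set T) : \bar R := (\int[m]_(x in A) w x)%E.

Let density_measure0 : density_measure set0 = 0%E.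
Proof. exact: integral_set0. Qed.

Let density_measure_ge0 A : (0 <= density_measure A)%E.
Proof. by apply: integral_ge0 => x _. Qed.

Let density_measure_sigma_additive : semi_sigma_additive density_measure.
Proof.
move=> F mF tF mUF; rewrite /density_measure ge0_integral_bigcup//; last first.
  exact: measurable_funTS.
by apply: is_cvg_nneseries => k _ _; exact: density_measure_ge0.
Qed.

HB.instance Definition _ := isMeasure.Build _ _ _ density_measure
  density_measure0 density_measure_ge0 density_measure_sigma_additive.

Definition density : {measure set T -> \bar R} := density_measure.

Import HBNNSimple.

Let integral_density_nnsfun (f : {nnsfun T >-> R}) :
  (\int[density_measure]_x (f x)%:E = \int[m]_x ((f x)%:E * w x))%E.
Proof.
rewrite integralT_nnsfun sintegralE.
transitivity (\int[m]_x \sum_(r \in range f)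
    ((r * \1_(f @^-1` [set r]) x)%:E * w x))%E; last first.
  apply: eq_integral => x _; rewrite -ge0_mule_fsuml; last first.
    by move=> r; rewrite nnfun_muleindic_ge0.
  by rewrite [in RHS]fimfunE -fsumEFin.
rewrite ge0_integral_fsum//; last 2 first.
- move=> r; apply: emeasurable_funM => //; apply/measurable_EFinP.
  exact: measurable_funM.
- by move=> r x _; rewrite mule_ge0 ?nnfun_muleindic_ge0.
apply: eq_fsbigr => r; rewrite inE => -[x _ fx].
have r0 : 0 <= r by rewrite -fx.
rewrite /= /density_measure -ge0_integralZl_EFin//; last exact: measurable_funTS.
rewrite integral_mkcond; apply: eq_integral => y _.
by rewrite patchE indicE; case: ifPn => _; rewrite ?mulr1 ?mulr0 ?mul0e.
Qed.

Lemma ge0_integral_density (f : T -> \bar R) : measurable_fun setT f ->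
  (forall x, 0 <= f x)%E -> (forall x, w x \is a fin_num) ->
  (\int[density_measure]_x f x = \int[m]_x (f x * w x))%E.
Proof.
move=> mf f0 w_fin; pose f_ := nnsfun_approx measurableT mf.
have f_cvg x : (f_ n x)%:E @[n --> \oo] --> f x.
  by apply: cvg_nnsfun_approx => // y _; exact: f0.
have f_nd x : nondecreasing_seq (fun n => (f_ n x)%:E).
  by move=> j k jk; rewrite lee_fin; exact/lefP/nd_nnsfun_approx.
transitivity (limn (fun n => \int[density_measure]_x (f_ n x)%:E)%E).
  rewrite -monotone_convergence//.
  - by apply: eq_integral => x _; apply/esym/cvg_lim.
  - by move=> n; exact/measurable_EFinP.
  - by move=> n x _; rewrite lee_fin.
under eq_fun do rewrite integral_density_nnsfun.
rewrite -monotone_convergence//.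
- apply: eq_integral => x _; apply/cvg_lim => //.
  (* Finiteness of w x lets the product pass to the limit even where f is infinite. *)
  by apply: cvgeZr; [exact: w_fin|exact: f_cvg].
- by move=> n; apply: emeasurable_funM => //; exact/measurable_EFinP.
- by move=> n x _; rewrite mule_ge0// lee_fin.
- by move=> x _ j k jk; rewrite lee_wpmul2r// f_nd.
Qed.

End Density.
End Disintegration.

(** * The law of the copula *)

Section Measurability.
Context {R : realType}.
Variables (N : nat) (psi : R -> R).
Hypothesis psi_gen : archimedean_generator psi.
Hypothesis psi_dm : d_monotone N.+2 psi.

Local Notation phi := (pseudo_inv psi).
Local Notation g := (generator_chain N psi).
Local Notation q := (generator_chain N psi N.+1).
Local Notation qe := (real_part_or0 (generator_chain N psi N.+1)).

Lemma top_extend0_measurable : measurable_fun setT (extend0 q).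
Proof.
have [_ mono _ _] := archimedean_chain N psi psi_gen psi_dm.
by apply: extend0_measurable => x y; exact: mono.
Qed.

Lemma pseudo_inv_measurable : measurable_fun (`[0, 1]%classic : set R) phi.
Proof.
apply: (measurability _ (ErealGenCInfty.measurableE R)) => _ [_ [r ->] <-].
apply: is_interval_measurable => x y /= [].
rewrite !in_itv/= => /andP[x0 x1] _ [/andP[y0 y1]].
rewrite !andbT => ry z /andP[xz zy].
have z0 := le_trans x0 xz; have z1 := le_trans zy y1.
rewrite !in_itv/= andbT z0 z1; split => //; apply: (le_trans ry).
exact: pseudo_inv_nincr.
Qed.

Lemma sum_phi_measurable n :
  measurable_fun (cubeI n) (fun x : n.-tuple R => sum_phi psi x).
Proof.
apply: emeasurable_sum => i.
apply: (@measurable_comp _ _ _ _ _ _ (`[0, 1]%classic : set R) phi _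
  (fun x : n.-tuple R => tnth x i)) => //.
- by move=> _ [x x01 <-]; rewrite /= in_itv/=; exact: x01.
- exact: pseudo_inv_measurable.
- by apply: measurable_funTS; exact: measurable_tnth.
Qed.

Lemma Kcdf_measurable y : 0 <= y <= 1 ->
  measurable_fun (cubeI N.+1) (fun x => Kcdf N.+2 psi x y).
Proof.
move=> y01.
(* On ]0, oo[ inversion is monotone, and the denominators that matter are positive. *)
pose inv (v : R) := extend0 (fun x => x^-1) v.
have minv : measurable_fun setT inv.
  by apply: extend0_measurable => u v u0 uv; rewrite lef_pV2 ?posrE// (lt_le_trans u0).
(* [fine] sends +oo to 0 and [extend0] sends 0 to 0, which reproduces the convention at infinity. *)
pose Phi (s : \bar R) : R := if (s == 0%E) || (phi 0 <= s)%E then 1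
  else extend0 q (fine (s + phi y)%E) * inv (extend0 q (fine s)).
have mPhi : measurable_fun setT Phi.
  apply: measurable_fun_ifT => //.
  - apply: measurable_or.
      by apply: measurable_fun_eqe => //; exact: measurable_cst.
    apply: (measurable_fun_bool true); rewrite setTI.
    rewrite (_ : _ @^-1` _ = `[phi 0, +oo[%classic); first exact: emeasurable_itv.
    by apply/seteqP; split => s /=; rewrite in_itv/= andbT.
  - apply: measurable_funM.
      apply: measurableT_comp; first exact: top_extend0_measurable.
      apply: measurableT_comp => //.
      by apply: emeasurable_funD => //; exact: measurable_cst.
    apply: measurableT_comp => //.
    by apply: measurableT_comp; first exact: top_extend0_measurable.
apply: (eq_measurable_fun (Phi \o (fun x : N.+1.-tuple R => sum_phi psi x))).
  move=> x; rewrite inE => x01; rewrite KcdfE// /= /Phi.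
  case: ifPn => //; rewrite negb_or -ltNge => /andP[S0 Sphi].
  have := sum_phi_ge0 psi _ x; have := pseudo_inv_ge0 psi y.
  have Sfin : sum_phi psi x \is a fin_num.
    by rewrite ge0_fin_numE ?sum_phi_ge0// (lt_le_trans Sphi) ?leey.
  move: S0 Sphi Sfin; case: (sum_phi psi x) => [r| |]//.
  rewrite eqe => rneq0 rphi _ phi0; rewrite lee_fin => r_ge0.
  have r0 : 0 < r by rewrite lt_neqAle eq_sym rneq0.
  have qr0 := top_gt0 N psi psi_gen psi_dm r r0 rphi.
  rewrite /= {2}/extend0 r0 /inv {2}/extend0 qr0; congr (_ * _).
  case: (phi y) phi0 => [s| |]//=; last by rewrite /extend0 ltxx.
  by rewrite lee_fin => s0; rewrite /extend0 ifT//; lra.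
by apply: measurableT_comp => //; exact: sum_phi_measurable.
Qed.

End Measurability.

Section CopulaMeasure.
Context {R : realType}.
Variables (N : nat) (psi : R -> R).
Hypothesis psi_gen : archimedean_generator psi.
Hypothesis psi_dm : d_monotone N.+2 psi.

Local Notation n := N.+1.
Local Notation phi := (pseudo_inv psi).
Local Notation g := (generator_chain N psi).
Local Notation q := (generator_chain N psi N.+1).
Local Notation qe := (real_part_or0 (generator_chain N psi N.+1)).

Let chain := archimedean_chain N psi psi_gen psi_dm.

(* The cut-off at phi(0) only matters when r = 0 and s = phi(0), where the left
   derivative q may be nonzero. *)
Definition shifted_chain (r : R) (k : nat) (s : R) : R :=
  if (k <= N)%N then g k (s + r)
  else if (s%:E < phi 0)%E then q (s + r) else 0.

(** Only the top slope bounds feel the cut-off. With q replaced by 0 the lower bound is monotonicity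
    of [g N]; the upper one at u >= phi(0) holds because [g N] vanishes at u + r. *)
Lemma shifted_chainP r : 0 <= r -> monotone_chain n (shifted_chain r).
Proof.
move=> r0; have [ge0 mono small slope] := chain.
have above (s : R) : ~~ (s%:E < phi 0)%E -> g N (s + r) = 0.
  rewrite -leNgt; have := generator_chain_eq0 N psi psi_gen psi_dm.
  have := pseudo_inv_ge0 psi 0; case: (phi 0) => [p| |]// _ /(_ p erefl)[_ eq0].
  by rewrite lee_fin => ps; apply: eq0; lra.
split => k; rewrite /shifted_chain.
- move=> x kn x0; case: ifP => kN; first by apply: ge0 => //; lra.
  by case: ifP => // _; apply: ge0 => //; lra.
- move=> x y kn x0 xy; case: ifP => kN; first by apply: mono => //; lra.
  case: ifPn => [yphi|_]; last by case: ifPn => // _; apply: ge0 => //; lra.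
  rewrite (le_lt_trans _ yphi) ?lee_fin//.
  by apply: mono => //; lra.
- move=> e kn e0; have [kN|kN] := boolP (k <= N)%N.
    have [M M0 HM] := small k e kn e0.
    by exists M => // x Mx; apply: HM; lra.
  have [M M0 HM] := small N.+1 e (leqnn _) e0.
  by exists M => // x Mx; case: ifP => // _; apply: HM; lra.
- move=> u v; rewrite ltnS => kN u0 uv; rewrite kN.
  have := slope k (u + r) (v + r) kN ltac:(lra) ltac:(lra).
  have -> : v + r - (u + r) = v - u by ring.
  case: ifP => // kN'; have {kN kN'} -> : k = N.
    by apply/eqP; rewrite eqn_leq kN leqNgt kN'.
  move=> /andP[lo up].
  have decr : g N (v + r) <= g N (u + r) by apply: mono => //; lra.
  apply/andP; split; first by case: ifP => // _; lra.
  case: ifPn => // /above ->.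
  have : 0 <= g N (v + r) by apply: ge0 => //; lra.
  lra.
Qed.

(** For b = phi(y), the density in z of the mass with last coordinate at most y. The cut-off keeps
    each z_i below phi(0), where phi inverts psi. *)
Definition copula_weight (b : \bar R) (z : n.-tuple R) : R :=
  if in_orthant [tuple 0%E | _ < n] z && ((tuple_sum z)%:E < phi 0)%E
  then qe ((tuple_sum z)%:E + b)%E else 0.

Lemma copula_weight_measurable b : (0 <= b)%E ->
  measurable_fun setT (EFin \o copula_weight b).
Proof.
move=> b0; apply/measurable_EFinP.
rewrite (_ : copula_weight b = fun z =>
    if in_orthant [tuple 0%E | _ < n] z && ((tuple_sum z)%:E < phi 0)%E
    then extend0 q (fine ((tuple_sum z)%:E + b)%E) else 0).
  apply: measurable_fun_ifT => //.
    apply: measurable_and; first exact: in_orthant_measurable.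
    apply: measurable_fun_lte => //.
    by apply/measurable_EFinP; exact: tuple_sum_measurable.
  apply: measurableT_comp; first exact: top_extend0_measurable.
  apply: measurableT_comp => //; apply: emeasurable_funD.
    by apply/measurable_EFinP; exact: tuple_sum_measurable.
  exact: measurable_cst.
apply/funext => z; rewrite /copula_weight; case: ifP => // /andP[z0 _].
have sz0 := tuple_sum_gt0 _ _ _ z0.
case: b b0 => [r| |]//=; last by rewrite /extend0 ltxx.
by rewrite lee_fin => r0; rewrite /extend0 ifT//; lra.
Qed.

Lemma copula_weight_ge0 b z : (0 <= b)%E -> (0 <= (EFin \o copula_weight b) z)%E.
Proof.
have [ge0 _ _ _] := chain.
move=> b0; rewrite /= lee_fin /copula_weight; case: ifP => // /andP[z0 _].
have sz0 := tuple_sum_gt0 _ _ _ z0.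
by case: b b0 => [r| |]//=; rewrite lee_fin => r0; apply: ge0 => //; lra.
Qed.

(** [psi] is unconstrained on negative reals; [psi_ext] equals 1 there, which makes the map monotone
    in each coordinate and valued in the cube. *)
Definition psi_tuple (z : n.-tuple R) : n.-tuple R :=
  [tuple psi_ext psi (tnth z i)%:E | i < n].

Lemma psi_tuple_measurable : measurable_fun setT psi_tuple.
Proof.
apply/measurable_fun_tnthP => i.
rewrite (_ : _ \o _ = (fun x : R => psi_ext psi x%:E) \o (fun z => tnth z i)).
  apply: measurableT_comp; last exact: measurable_tnth.
  apply: nonincreasing_measurable => // x y xy /=.
  case: ltP => y0; case: ltP => x0 //; try lra.
    by apply: (generator_le1 _ psi_gen).
  exact: (generator_nincr _ psi_gen).
by apply/funext => z; rewrite /= tnth_mktuple.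
Qed.

Lemma psi_tuple_cube z : cubeI n (psi_tuple z).
Proof.
move=> i; rewrite tnth_mktuple /=; case: ltP => z0; first by rewrite ler01 lexx.
by rewrite (generator_ge0 _ psi_gen)// (generator_le1 _ psi_gen).
Qed.

Section CopulaLaw.
Variable b : \bar R.
Hypothesis b0 : (0 <= b)%E.

Definition weighted_lebesgue : {measure set (n.-tuple R) -> \bar R} :=
  density _ _ (lebesgue_tuple n) _ (copula_weight_measurable b b0)
    (fun z => copula_weight_ge0 b z b0).

Definition copula_law : {measure set (n.-tuple R) -> \bar R} :=
  image_measure weighted_lebesgue psi_tuple_measurable.

Lemma copula_lawE A : copula_law A =
  (\int[lebesgue_tuple n]_(z in psi_tuple @^-1` A) (copula_weight b z)%:E)%E.
Proof. by []. Qed.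

Lemma copula_law_cubeC : copula_law (~` cubeI n) = 0%E.
Proof.
rewrite copula_lawE (_ : _ @^-1` _ = set0) ?integral_set0//.
by apply/seteqP; split => // z /= /(_ (psi_tuple_cube z)).
Qed.

Lemma copula_law_lower_box c : cubeI n c ->
  copula_law (lower_box c) = (psi_ext psi (sum_phi psi c + b)%E)%:E.
Proof.
move=> c01; rewrite copula_lawE.
case: b b0 => [r|_|//]; last first.
  rewrite addey; last first.
    by have := sum_phi_ge0 psi _ c; case: (sum_phi psi c).
  rewrite integral0_eq// => z _; rewrite /copula_weight.
  by case: ifP => // _; rewrite addey.
rewrite lee_fin => r0.
pose a := [tuple phi (tnth c i) | i < n].
have boxE z : in_orthant [tuple 0%E | _ < n] z ->
    in_orthant a z = `[< lower_box c (psi_tuple z) >].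
  move=> /forallP z0; apply/forallP/asboolP => H i.
    have /andP[zi _] := z0 i; have /andP[_] := H i.
    rewrite !tnth_mktuple /= ltNge (ltW zi)/=.
    by rewrite (pseudo_inv_le _ psi_gen _ _ (c01 i) (ltW zi)).
  have /andP[zi _] := z0 i; have := H i.
  rewrite !tnth_mktuple /= ltNge (ltW zi)/= zi.
  by rewrite (pseudo_inv_le _ psi_gen _ _ (c01 i) (ltW zi)).
have orthant0 z : in_orthant a z -> in_orthant [tuple 0%E | _ < n] z.
  move=> /forallP H; apply/forallP => i; have /andP[zi _] := H i.
  by rewrite tnth_mktuple zi lee_fin ltW.
transitivity (\int[lebesgue_tuple n]_z
    (if in_orthant a z then shifted_chain r n (0 + tuple_sum z)%R else 0%R)%:E)%E.
  rewrite integral_mkcond; apply: eq_integral => z _; rewrite patchE.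
  rewrite /shifted_chain ltnn add0r /copula_weight.
  have [z0|z0] := boolP (in_orthant [tuple 0%E | _ < n] z); last first.
    rewrite if_same ifF//; apply/negbTE; apply: contra z0; exact: orthant0.
  rewrite boxE// (_ : (z \in _) = `[< lower_box c (psi_tuple z) >]).
    by case: ifP.
  by apply/idP/asboolP; rewrite inE.
(* The offset is 0 and r sits inside the chain, since the cut-off concerns the sum of z alone.
   Right-continuity at 0 is then that of psi at r. *)
rewrite (chain_integral _ _ _ _ (shifted_chainP r r0))//; last 2 first.
- right => e e0; have [d d0 Hd] := generator_right_continuous _ psi_gen r r0 e e0.
  exists d => // y y0 yd; rewrite /shifted_chain generator_chain0 add0r.
  by apply: Hd; lra.
- by move=> i; rewrite tnth_mktuple; exact: pseudo_inv_ge0.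
have -> : (\sum_(i < n) tnth a i)%E = sum_phi psi c.
  by apply: eq_bigr => i _; rewrite tnth_mktuple.
rewrite add0e; have := sum_phi_ge0 psi _ c; case: (sum_phi psi c) => [s| |]//=.
rewrite lee_fin => s0; rewrite /shifted_chain generator_chain0.
by rewrite [s + r < 0]ltNge addr_ge0.
Qed.

End CopulaLaw.

(** The quotient of densities, stated as a product. On the support of the weight the phi(psi(z_i))
    add up to the sum of z, where q is positive; elsewhere both sides are 0. *)
Lemma Kcdf_weight y z : 0 <= y <= 1 ->
  Kcdf n.+1 psi (psi_tuple z) y * copula_weight 0 z = copula_weight (phi y) z.
Proof.
move=> y01; rewrite /copula_weight; case: ifP; rewrite ?mulr0//.
move=> /andP[z0 zphi]; have sz0 := tuple_sum_gt0 _ _ _ z0.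
have zi i : 0 < tnth z i by move: z0 => /forallP /(_ i) /andP[].
have zi_le i : tnth z i <= tuple_sum z.
  rewrite /tuple_sum (bigD1 i)//= lerDl; apply: sumr_ge0 => j _; exact: ltW.
have sumE : sum_phi psi (psi_tuple z) = (tuple_sum z)%:E.
  rewrite /sum_phi /tuple_sum -sumEFin; apply: eq_bigr => i _.
  rewrite tnth_mktuple /= ltNge ltW//= pseudo_inv_generator ?ltW//.
  by apply: le_lt_trans zphi; rewrite lee_fin.
rewrite KcdfE//; last exact: psi_tuple_cube.
rewrite sumE leNgt zphi orbF eqe gt_eqF//= addr0.
rewrite divfK// gt_eqF//; exact: top_gt0.
Qed.

End CopulaMeasure.

(** * Disintegration of the copula measure *)

Section MarkovKernel.
Context {R : realType}.
Variables (N : nat) (psi : R -> R).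
Variable mu : probability (N.+1.-tuple R * R)%type R.
Hypothesis psi_gen : archimedean_generator psi.
Hypothesis psi_dm : d_monotone N.+2 psi.
Hypothesis mu_copula : is_copula_measure psi mu.

Local Notation n := N.+1.
Local Notation phi := (pseudo_inv psi).

Let unitI_measurable : measurable (unitI : set R).
Proof.
rewrite (_ : unitI = `[0, 1]%classic); first exact: measurable_itv.
by apply/seteqP; split => x; rewrite /= in_itv.
Qed.

Lemma copula_measure_setI A : measurable A ->
  mu A = mu (A `&` (cubeI n `*` unitI)).
Proof.
move=> mA; apply: measure_setI_conull => //; last by case: mu_copula.
by apply: measurableX => //; exact: cubeI_measurable.
Qed.

(** For fixed y both sides are measures in A carried by the cube, and on boxes both equal the value
    of the copula. *)
Lemma copula_measure_rect y A : 0 <= y <= 1 -> measurable A ->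
  mu (A `*` `]-oo, y]) = copula_law N psi psi_gen psi_dm (phi y) (pseudo_inv_ge0 psi y) A.
Proof.
move=> y01 mA.
have mD : measurable ([set: n.-tuple R] `*` `]-oo, y]%classic).
  exact: measurableX.
pose m := image_measure (mrestr mu mD) measurable_fst.
have mE B : m B = mu (B `*` `]-oo, y]).
  rewrite /m /= /pushforward /mrestr; congr (mu _).
  by apply/seteqP; split => -[x z] /=; tauto.
rewrite -mE; apply: cube_measure_unique => //.
- by rewrite mE (le_lt_trans (probability_le1 _ _)) ?ltry//; exact: measurableX.
- have mC := measurableC (cubeI_measurable (R := R) n).
  rewrite mE copula_measure_setI; last exact: measurableX.
  rewrite (_ : _ `&` _ = set0) ?measure0//.
  by apply/seteqP; split => // -[x z] /= [[+ _] [+ _]].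
- exact: copula_law_cubeC.
- move=> c c01; rewrite mE copula_law_lower_box//.
  case: mu_copula => _ /(_ c y c01 y01) <-.
  by congr (mu _); apply/seteqP; split => -[x z].
Qed.

Lemma copula_marginalE A : measurable A ->
  pushforward mu fst A = copula_law N psi psi_gen psi_dm (phi 1) (pseudo_inv_ge0 psi 1) A.
Proof.
move=> mA; rewrite -copula_measure_rect ?ler01 ?lexx// /pushforward.
rewrite copula_measure_setI; last first.
  by rewrite -[X in measurable X]setTI; exact: measurable_fst.
rewrite [RHS]copula_measure_setI; last exact: measurableX.
congr (mu _); apply/seteqP; split => -[x z] /=.
  by move=> [xA [xc z01]]; split => //; split => //; rewrite in_itv/=; case/andP: z01.
by move=> [[xA _] xzc].
Qed.

(** [F] stands for any globally measurable nonnegative extension of the kernel from the cube, which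
    carries the law of X. In z coordinates the integrand becomes the weight for phi(y). *)
Lemma integral_Kcdf y A (F : n.-tuple R -> \bar R) : 0 <= y <= 1 -> measurable A ->
  measurable_fun setT F -> (forall x, 0 <= F x)%E ->
  (forall x, cubeI n x -> F x = (Kcdf n.+1 psi x y)%:E) ->
  (\int[pushforward mu fst]_(x in A) F x)%E = mu (A `*` `]-oo, y]).
Proof.
move=> y01 mA mF F0 FE; rewrite copula_measure_rect// copula_lawE.
rewrite (eq_measure_integral (copula_law N psi psi_gen psi_dm (phi 1)
  (pseudo_inv_ge0 psi 1))); last by move=> B mB _; exact: copula_marginalE.
have mT := psi_tuple_measurable N psi psi_gen.
have mTA : measurable (psi_tuple N psi @^-1` A).
  by rewrite -[X in measurable X]setTI; exact: mT.
rewrite ge0_integral_pushforward//; last exact: measurable_funTS.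
have mw1 := copula_weight_measurable N psi psi_gen psi_dm _ (pseudo_inv_ge0 psi 1).
have w1_ge0 z := copula_weight_ge0 N psi psi_gen psi_dm _ z (pseudo_inv_ge0 psi 1).
rewrite integral_mkcond ge0_integral_density//; last 2 first.
- apply/(measurable_restrictT _ mTA); apply: measurable_funTS.
  exact: measurableT_comp.
- by move=> z; apply: erestrict_ge0 => x _; exact: F0.
rewrite [RHS]integral_mkcond; apply: eq_integral => z _; rewrite !patchE.
case: ifPn => _; last by rewrite mul0e.
rewrite /= FE; last exact: psi_tuple_cube.
by rewrite -EFinM -(Kcdf_weight N psi psi_gen psi_dm y z y01) pseudo_inv1.
Qed.

Lemma kernel_cubeI_markov (K : n.-tuple R -> probability R R) :
  induced_kernel n.+1 psi (fun x => K x) ->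
  is_markov_kernel mu (fun x => K x).
Proof.
move=> K_ind.
(* [K] is arbitrary, possibly not measurable, outside the cube. *)
pose K' (x : n.-tuple R) : probability R R :=
  if x \in cubeI n then K x else \d_(0 : R).
have K'E x : cubeI n x -> K' x = K x by move=> x01; rewrite /K' mem_set.
have mcube := cubeI_measurable (R := R) n.
have memcube : measurable_fun setT (fun x : n.-tuple R => x \in cubeI n).
  apply: (measurable_fun_bool true); rewrite setTI.
  rewrite (_ : _ @^-1` _ = cubeI n)//.
  by apply/seteqP; split => x /=; [exact: set_mem|exact: mem_set].
have K'neg x y : y < 0 -> K' x `]-oo, y] = 0%E.
  move=> y0; rewrite /K'; case: ifPn => [|_].
    rewrite inE => x01; have [KC _] := K_ind x x01.
    apply/eqP; rewrite -measure_le0 -KC le_measure ?inE//.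
      exact: measurableC.
    move=> z /=; rewrite in_itv/= => zy /andP[z0 _].
    by have := le_lt_trans (le_trans z0 zy) y0; rewrite ltxx.
  by rewrite /= /dirac indicE memNset//= in_itv/=; apply/negP; rewrite -ltNge.
have K'top x y : 1 <= y -> K' x `]-oo, y] = 1%E.
  move=> y1; rewrite /K'; case: ifPn => [|_].
    rewrite inE => x01; have [KC _] := K_ind x x01.
    rewrite -(probability_setT (K x)).
    rewrite (measure_setI_conull _ _ (K x) unitI)//.
    rewrite [RHS](measure_setI_conull _ _ (K x) unitI)//.
    congr (K x _); apply/seteqP; split => z [_ z01]; split => //=.
    by rewrite in_itv/=; case/andP: z01 => _ /le_trans; apply.
  by rewrite /= /dirac indicE mem_set//= in_itv/= (le_trans ler01).
have K'mid x y : cubeI n x -> 0 <= y <= 1 ->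
    K' x `]-oo, y] = (Kcdf n.+1 psi x y)%:E.
  move=> x01 y01; have [KC <-//] := K_ind x x01.
  rewrite K'E// (measure_setI_conull _ _ (K x) unitI)//.
  congr (K x _); apply/seteqP; split => z /=; rewrite !in_itv/=.
    by move=> [-> /andP[-> _]].
  move=> /andP[z0 zy]; split => //; rewrite /unitI/= z0.
  by case/andP: y01 => _; apply: le_trans.
have mK'_ray y : measurable_fun setT (fun x => K' x `]-oo, y]).
  have [y0|y0] := ltP y 0.
    by rewrite (_ : (fun x => _) = cst 0%E)//; apply/funext => x; rewrite K'neg.
  have [y1|/ltW y1] := leP 1 y.
    by rewrite (_ : (fun x => _) = cst 1%E)//; apply/funext => x; rewrite K'top.
  have y01 : 0 <= y <= 1 by rewrite y0.
  rewrite (_ : (fun x => _) = fun x => (if x \in cubeI n then Kcdf n.+1 psi x y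
                                         else 1)%:E).
    apply/measurable_EFinP; apply: measurable_fun_if => //.
    rewrite setTI (_ : _ @^-1` _ = cubeI n); first exact: Kcdf_measurable.
    by apply/seteqP; split => x /=; [exact: set_mem|exact: mem_set].
  apply/funext => x; case: ifPn => xc; first by rewrite K'mid// -inE.
  by rewrite /K' (negbTE xc) /= /dirac indicE mem_set//= in_itv.
have mK' := measurable_kernel_closed_rays _ _ K' mK'_ray.
have marginal_cubeC : pushforward mu fst (~` cubeI n) = 0%E.
  by rewrite copula_marginalE ?copula_law_cubeC//; exact: measurableC.
split=> [E mE|G mG].
  apply: (eq_measurable_fun (fun x => K' x E)).
    by move=> x; rewrite inE => x01; rewrite K'E.
  by apply: measurable_funTS; exact: mK'.
have marginalC A : measurable A -> pushforward mu fst A = mu (A `*` setT).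
  move=> mA; rewrite /pushforward; congr (mu _).
  by apply/seteqP; split => -[x z] //= [].
pose marginal := image_measure mu measurable_fst.
rewrite (kernel_disintegration _ _ marginal K' mK' mu)//; last 2 first.
- by rewrite (le_lt_trans (probability_le1 _ _)) ?ltry.
- move=> A y mA; have [y0|y0] := ltP y 0.
    under eq_integral do rewrite K'neg//.
    rewrite integral0 [LHS]copula_measure_setI; last exact: measurableX.
    rewrite (_ : _ `&` _ = set0) ?measure0//.
    apply/seteqP; split => // -[x z] /= [[_ +] [_ /andP[z0 _]]].
    by rewrite in_itv/= => zy; have := le_lt_trans (le_trans z0 zy) y0; rewrite ltxx.
  have [y1|/ltW y1] := leP 1 y.
    under eq_integral do rewrite K'top//.
    rewrite integral_cst// mul1e /marginal/= marginalC//.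
    rewrite [LHS]copula_measure_setI; last exact: measurableX.
    rewrite [RHS]copula_measure_setI; last exact: measurableX.
    congr (mu _); apply/seteqP; split => -[x z] /= [[xA _] [xc z01]]; split => //.
    by split => //; rewrite in_itv/=; case/andP: z01 => _ /le_trans; apply.
  have y01 : 0 <= y <= 1 by rewrite y0.
  by apply/esym/integral_Kcdf => // x x01; exact: K'mid.
(* The complement of the cube is null for the law of X, so the integral restricts to the cube, where
   [K'] is [K]. *)
transitivity (\int[marginal]_(x in cubeI n) K' x (xsection G x))%E.
  have mKG := measurable_kernel_xsection _ _ K' mK' G mG.
  by rewrite (ge0_negligible_integral (measurableC mcube))// setTD setCK.
apply: eq_integral => x; rewrite inE => x01; rewrite K'E//.
by congr (K x _); apply/seteqP; split => y; rewrite /xsection/= inE.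
Qed.

End MarkovKernel.

Theorem theorem3p1 (R : realType) (d : nat) (psi : R -> R)
    (mu : probability ((d.-1).-tuple R * R)%type R) :
  (3 <= d)%N ->
  archimedean_generator psi -> d_monotone d psi -> psi 1 = 2^-1 ->
  is_copula_measure psi mu ->
  (forall x : (d.-1).-tuple R, cubeI (d.-1) x -> is_df_on_I (Kcdf d psi x)) /\
  (exists K : (d.-1).-tuple R -> probability R R,
      induced_kernel d psi (fun x => K x)) /\
  (forall K : (d.-1).-tuple R -> probability R R,
      induced_kernel d psi (fun x => K x) ->
      is_markov_kernel mu (fun x => K x)).
Proof.
case: d mu => [|[|N]]// mu _ psi_gen psi_dm _ mu_copula.
have df x : cubeI N.+1 x -> is_df_on_I (Kcdf N.+2 psi x).
  exact: Kcdf_is_df.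
split=> //; split; last first.
  by move=> K; apply: kernel_cubeI_markov.
(* Laws may be chosen for each x separately: measurability in x is recovered from the distribution
   functions in [kernel_cubeI_markov]. *)
have /choice[K KP] : forall x : N.+1.-tuple R, exists P : probability R R,
    cubeI N.+1 x -> P (~` unitI) = 0%E /\
      forall y, unitI y -> P `[0, y] = (Kcdf N.+2 psi x y)%:E.
  move=> x; have [x01|xC] := pselect (cubeI N.+1 x).
    by have [P HP] := df_probability _ (df x x01); exists P.
  by exists (\d_(0 : R)) => /xC.
by exists K => x /KP.
Qed.
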